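(* Let $X$ be a non-empty set. For any positive definite kernel $L$ on $X$ that has a pdms root there exists a unique pdms root $K$ of $L$ such that the closure of $K_{op}\colon\ell_{fin}(X)\to\ell_2(X)$ is self-adjoint.
   Context: A kernel on $X$ is a function $K\colon X\times X\to\mathbb C$; it is positive definite if $\sum_{j,k=1}^n\lambda_j\overline{\lambda_k}K(x_j,x_k)\ge0$ for all $n\ge1$, $x_j\in X$, $\lambda_j\in\mathbb C$. A positive definite kernel $K$ on $X$ is a pdms root (positive definite matrix-type square root) of a positive definite kernel $L$ on $X$ if $L(x,z)=\sum_{y\in X}K(x,y)K(y,z)$ for all $x,z\in X$; then $K(x,\cdot)\in\ell_2(X)$ for all $x\in X$. $\ell_{fin}(X)$ is the linear span of the canonical basis $(e_x)_{x\in X}$ of $\ell_2(X)$. $K_{op}$ is the linear operator with domain $\ell_{fin}(X)$, viewed as a dense subspace of $\ell_2(X)$, given by $K_{op}(e_x)=K(x,\cdot)$; it is closable as an operator into $\ell_2(X)$ when all $K(x,\cdot)$ and $K(\cdot,x)$ are in $\ell_2(X)$. *)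

(* Defs.v *)
From HB Require Import structures.
From mathcomp Require Import all_boot all_order all_algebra finmap.
From mathcomp Require Import all_classical all_reals all_analysis.
From mathcomp.analysis.showcase Require Export summability.
From mathcomp.real_closed Require Export complex.

Set Implicit Arguments.
Unset Strict Implicit.
Unset Printing Implicit Defensive.
Import Order.TTheory GRing.Theory Num.Theory.
Import numFieldNormedType.Exports.

Local Open Scope classical_set_scope.
Local Open Scope ring_scope.

Section kernels.
Variables (R : realType) (X : choiceType).
Local Notation C := R[i].

Definition ckernel := X -> X -> C.

(* The order of C only compares numbers with the same imaginary part, so
   0 <= z says that z is real and nonnegative. *)
Definition positive_definite (K : ckernel) : Prop :=
  forall (n : nat) (x : 'I_n -> X) (lambda : 'I_n -> C), (0 < n)%N ->
    0 <= \sum_(j < n) \sum_(k < n) lambda j * (lambda k)^* * K (x j) (x k).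

(* Unordered summation over X, which may be uncountable: convergence of the net
   of finite partial sums. R[i]^o carries the norm topology of C. *)
Definition has_sum (u : X -> C) (s : C) : Prop :=
  partial_sum (u : X -> R[i]^o) @ totally --> (s : R[i]^o).

Definition pdms_root (L K : ckernel) : Prop :=
  positive_definite K /\
  forall x z : X, has_sum (fun y => K x y * K y z) (L x z).

Definition sqnorm2 (f : X -> C) : \bar R :=
  (\esum_(x in [set: X]) (Normc.normc (f x) ^+ 2)%:E)%E.

Definition ell2 : set (X -> C) := [set f | (sqnorm2 f < +oo)%E].

(* Linear in the first argument; the unordered sum converges for all f and g
   in ell2. *)
Definition dot2 (f g : X -> C) : C :=
  sum ((fun x => f x * (g x)^*) : X -> R[i]^o).

Definition ell_fin : set (X -> C) := [set f | finite_set [set x | f x != 0]].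

(* An unbounded operator in ell2 is represented by its graph. *)
Definition op_graph := set ((X -> C) * (X -> C)).

Definition op_domain (G : op_graph) : set (X -> C) := [set p.1 | p in G].

Definition linear_operator (G : op_graph) : Prop :=
  [/\ G `<=` ell2 `*` ell2,
      G (0, 0),
      forall (a : C) (f g f' g' : X -> C), G (f, g) -> G (f', g') ->
        G (fun x => a * f x + f' x, fun x => a * g x + g' x) &
      forall f g g' : X -> C, G (f, g) -> G (f, g') -> g = g'].

Definition densely_defined (G : op_graph) : Prop :=
  forall f, ell2 f -> forall e : R, 0 < e ->
    exists2 h, op_domain G h & (sqnorm2 (f - h)%R < (e ^+ 2)%:E)%E.

(* The closure of the graph in ell2 x ell2; it is the graph of the closure of
   the operator when the latter is closable. *)
Definition op_closure (G : op_graph) : op_graph :=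
  [set p | [/\ ell2 p.1, ell2 p.2 & forall e : R, 0 < e ->
     exists2 q, G q & (sqnorm2 (p.1 - q.1)%R < (e ^+ 2)%:E)%E /\
                      (sqnorm2 (p.2 - q.2)%R < (e ^+ 2)%:E)%E]].

Definition adjoint (G : op_graph) : op_graph :=
  [set p | [/\ ell2 p.1, ell2 p.2 &
     forall f g, G (f, g) -> dot2 g p.1 = dot2 f p.2]].

Definition self_adjoint (G : op_graph) : Prop :=
  [/\ linear_operator G, densely_defined G & G = adjoint G].

(* f = \sum_x f x e_x is sent to \sum_x f x K(x, .), a finite sum for f in
   ell_fin. *)
Definition Kop (K : ckernel) : op_graph :=
  [set (f, fun y => \sum_(x \in [set: X]) f x * K x y) | f in ell_fin].

End kernels.

(* Main.v *)
From HB Require Import structures.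
Require Import Defs.
From mathcomp Require Import all_boot all_order all_algebra finmap.
From mathcomp Require Import all_classical all_reals all_analysis.
From mathcomp Require Import ring lra.

(** The closure T of K_op is a closed densely defined operator, and the root
    that the theorem asks for is read off from its modulus |T|: this operator is
    positive and self-adjoint, has the domain of T and satisfies
    |  |T| f | = | T f |.  Hence finitely supported vectors still form a core,
    the kernel K'(x, y) = < |T| e_x, e_y > satisfies
    < K' e_x, K' e_z > = < T e_x, T e_z > = L(x, z), and the closure of K'_op is
    |T| itself.

    The modulus is built without any spectral theory.  Let B and S be the two
    components of the orthogonal projection of (h, 0) onto the graph of T, that
    is B = (1 + T*T)^-1 and S = T B.  Then 0 <= B <= 1, and the bounded operator
    B - B^2 has a positive square root C, which is to be |T| B.  The graph of
    |T| is defined as the set of all pairs (u, v) with C u = B v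
    ([modulus_graph]).  The identity C^2 = B - B^2 makes the pairs (B h, C h)
    dense in it ([modulus_dense]), from which self-adjointness
    ([modulus_selfadj]) and positivity follow.  As |(B h, S h)|^2 = < B h, h >
    = |(B h, C h)|^2, the map (B h, S h) |-> (B h, C h) is isometric between
    dense subsets of both graphs and keeps the first component, so T and |T|
    have the same domain and the same norms ([modulus_exists]).

    For uniqueness, two roots of L give operators with | K f | = | K' f | on
    finitely supported f, since both squares are sum f(x) f(z)^* L(x, z).
    Their closures therefore have the same domain and norms, hence the same B.
    If a closure A is self-adjoint and positive, then A B is a positive square
    root of B - B^2; bounded positive square roots are unique, so A B = C and
    the graph of A is again the set of pairs with C u = B v
    ([selfadj_resolvent], [selfadj_modulus_unique]).

    The Hilbert space arguments take place in a real Hilbert space: complex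
    l2(X) is regarded as one through the real part of its inner product, and
    multiplication by i becomes an operator commuting with all the others. *)

Set Implicit Arguments.
Unset Strict Implicit.
Unset Printing Implicit Defensive.
Import Order.TTheory GRing.Theory Num.Theory.
Import numFieldNormedType.Exports.
Local Open Scope classical_set_scope.
Local Open Scope ring_scope.

(** * Geometry of real Hilbert spaces *)

(** Completeness is stated with squared norms, which spares square roots when a
    concrete space is shown to be an instance. *)
Record hilbert (R : realType) := Hilbert {
  hilbert_sort :> lmodType R;
  dot : hilbert_sort -> hilbert_sort -> R;
  dotC : forall x y, dot x y = dot y x;
  dotP : forall a x y z, dot (a *: x + y) z = a * dot x z + dot y z;
  dot_ge0 : forall x, 0 <= dot x x;
  dot_eq0 : forall x, dot x x = 0 -> x = 0;
  dot_complete : forall u : nat -> hilbert_sort,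
    (forall e, 0 < e -> exists N, forall m n, (N <= m)%N -> (N <= n)%N ->
       dot (u m - u n) (u m - u n) < e) ->
    exists l, forall e, 0 < e -> exists N, forall n, (N <= n)%N ->
       dot (u n - l) (u n - l) < e }.

Section Geometry.
Variables (R : realType) (H : hilbert R).
Implicit Types (x y z : H) (u v : nat -> H) (S G : set H).

Lemma dotDl x y z : dot (x + y) z = dot x z + dot y z.
Proof. by rewrite -[x in LHS]scale1r dotP mul1r. Qed.
Lemma dot0l x : dot 0 x = 0.
Proof. by have := dotDl 0 0 x; rewrite addr0 => h; lra. Qed.
Lemma dotZl a x z : dot (a *: x) z = a * dot x z.
Proof. by rewrite -[_ *: _ in LHS]addr0 dotP dot0l addr0. Qed.
Lemma dotNl x z : dot (- x) z = - dot x z.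
Proof. by rewrite -scaleN1r dotZl mulN1r. Qed.
Lemma dotBl x y z : dot (x - y) z = dot x z - dot y z.
Proof. by rewrite dotDl dotNl. Qed.
Lemma dotDr x y z : dot z (x + y) = dot z x + dot z y.
Proof. by rewrite dotC dotDl !(dotC z). Qed.
Lemma dot0r x : dot x 0 = 0. Proof. by rewrite dotC dot0l. Qed.
Lemma dotZr a x z : dot z (a *: x) = a * dot z x.
Proof. by rewrite dotC dotZl (dotC z). Qed.
Lemma dotNr x z : dot z (- x) = - dot z x.
Proof. by rewrite dotC dotNl (dotC z). Qed.
Lemma dotBr x y z : dot z (x - y) = dot z x - dot z y.
Proof. by rewrite dotDr dotNr. Qed.
Definition dotE := (dotDl, dotDr, dotNl, dotNr, dotZl, dotZr, dot0l, dot0r).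

Lemma dot_inj x y : (forall z, dot x z = dot y z) -> x = y.
Proof.
move=> h; apply/eqP; rewrite -subr_eq0; apply/eqP/dot_eq0.
by rewrite dotBl h subrr.
Qed.

(** Cauchy-Schwarz: expand the square norm of |y|^2 x - <x, y> y. *)
Lemma dot_sqr_le x y : dot x y ^+ 2 <= dot x x * dot y y.
Proof.
have [y0|yN0] := eqVneq (dot y y) 0.
  by rewrite (dot_eq0 y0) !dot0r mulr0 expr0n.
have yp : 0 < dot y y by rewrite lt_neqAle eq_sym yN0 dot_ge0.
have := dot_ge0 (dot y y *: x - dot x y *: y).
rewrite !dotE (dotC y x) => h.
rewrite -(ler_pM2l yp) -subr_ge0.
apply: le_trans h _; rewrite le_eqVlt; apply/orP; left; apply/eqP; ring.
Qed.

Definition norm x := Num.sqrt (dot x x).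
Lemma norm_ge0 x : 0 <= norm x. Proof. exact: sqrtr_ge0. Qed.
Lemma norm_sqr x : norm x ^+ 2 = dot x x.
Proof. by rewrite sqr_sqrtr // dot_ge0. Qed.
Lemma norm_eq x y : dot x x = dot y y -> norm x = norm y.
Proof. by rewrite /norm => ->. Qed.
Lemma norm_le x c : 0 <= c -> (norm x <= c) = (dot x x <= c ^+ 2).
Proof. by move=> c0; rewrite -norm_sqr ler_sqr // nnegrE norm_ge0. Qed.
Lemma norm_lt x c : 0 <= c -> (norm x < c) = (dot x x < c ^+ 2).
Proof. by move=> c0; rewrite -norm_sqr ltr_sqr // nnegrE norm_ge0. Qed.

Lemma normr_dot x y : `|dot x y| <= norm x * norm y.
Proof.
rewrite -ler_sqr ?nnegrE ?mulr_ge0 ?norm_ge0 //.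
by rewrite exprMn !norm_sqr real_normK ?num_real // dot_sqr_le.
Qed.

Lemma normD x y : norm (x + y) <= norm x + norm y.
Proof.
rewrite norm_le ?addr_ge0 ?norm_ge0 // !dotE sqrrD !norm_sqr (dotC y x).
have := normr_dot x y; have := ler_norm (dot x y); lra.
Qed.

Lemma normZ a x : norm (a *: x) = `|a| * norm x.
Proof. by rewrite /norm !dotE mulrA -expr2 sqrtrM ?sqr_ge0 // sqrtr_sqr. Qed.
Lemma normN x : norm (- x) = norm x.
Proof. by rewrite -scaleN1r normZ normrN1 mul1r. Qed.
Lemma norm0 : norm 0 = 0. Proof. by rewrite /norm dot0l sqrtr0. Qed.
Lemma normBC x y : norm (x - y) = norm (y - x).
Proof. by rewrite -normN opprB. Qed.

Definition tends u x := (fun n => norm (u n - x)) @ \oo --> (0 : R).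

Lemma squeeze0 (f g : nat -> R) : (forall n, `|f n| <= g n) ->
  g @ \oo --> (0 : R) -> f @ \oo --> (0 : R).
Proof.
move=> fg g0; apply/norm_cvg0P.
apply: (squeeze_cvgr _ (cvg_cst 0) g0).
by near=> n; rewrite normr_ge0 fg.
Unshelve. all: by end_near. Qed.

Lemma tendsP u x : (forall e, 0 < e -> exists N, forall n, (N <= n)%N ->
    dot (u n - x) (u n - x) < e) -> tends u x.
Proof.
move=> h; apply/cvgrPdist_lt => e e0.
have [N hN] := h _ (exprn_gt0 2 e0).
exists N => // n /= Nn; rewrite sub0r normrN ger0_norm ?norm_ge0 //.
by rewrite norm_lt ?hN // ltW.
Qed.

Lemma tends_complete u : (forall e, 0 < e -> exists N, forall m n,
    (N <= m)%N -> (N <= n)%N -> norm (u m - u n) < e) ->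
  exists x, tends u x.
Proof.
move=> h; have [|x hx] := @dot_complete _ H u; last by exists x; apply: tendsP.
move=> e e0; have [N hN] := h (Num.sqrt e) ltac:(by rewrite sqrtr_gt0).
exists N => m n Nm Nn; have := hN _ _ Nm Nn.
by rewrite norm_lt ?sqrtr_ge0 // sqr_sqrtr // ltW.
Qed.

Lemma tends_cauchy u x : tends u x -> forall e, 0 < e -> exists N, forall m n,
    (N <= m)%N -> (N <= n)%N -> norm (u m - u n) < e.
Proof.
move=> /cvgrPdist_lt h e e0; have [N _ hN] := h (e / 2) ltac:(lra).
exists N => m n Nm Nn; have := hN _ Nm; have := hN _ Nn; rewrite /= !sub0r.
rewrite !normrN !ger0_norm ?norm_ge0 // => h1 h2.
have -> : u m - u n = (u m - x) + (x - u n) by rewrite addrA subrK.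
apply: le_lt_trans (normD _ _) _; rewrite (normBC x); lra.
Qed.

Lemma tends_cst x : tends (fun=> x) x.
Proof. by rewrite /tends subrr norm0; exact: cvg_cst. Qed.

Lemma tendsD u v x y : tends u x -> tends v y ->
  tends (fun n => u n + v n) (x + y).
Proof.
move=> h k; apply: squeeze0 (fun n => norm (u n - x) + norm (v n - y)) _ _.
  move=> n; rewrite ger0_norm ?norm_ge0 //.
  by apply: le_trans (normD _ _); rewrite opprD addrACA.
by rewrite -[0]addr0; apply: cvgD.
Qed.

Lemma tendsZ a u x : tends u x -> tends (fun n => a *: u n) (a *: x).
Proof.
move=> h; rewrite /tends.
under eq_fun do rewrite -scalerBr normZ.
by rewrite -[0](mulr0 `|a|); apply: cvgZr.
Qed.

Lemma tendsN u x : tends u x -> tends (fun n => - u n) (- x).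
Proof.
by move=> /(tendsZ (-1)); rewrite scaleN1r; under eq_fun do rewrite scaleN1r.
Qed.

Lemma cvg_dot u v x y : tends u x -> tends v y ->
  (fun n => dot (u n) (v n)) @ \oo --> dot x y.
Proof.
move=> h k.
have -> : (fun n => dot (u n) (v n)) = (fun n =>
  (dot (u n - x) (v n - y) + dot (u n - x) y + dot x (v n - y)) + dot x y).
  by apply/funext => n; rewrite !dotE; ring.
rewrite -[X in _ --> X]add0r; apply: cvgD; last exact: cvg_cst.
apply: (@squeeze0 _ (fun n => norm (u n - x) * norm (v n - y) +
   norm (u n - x) * norm y + norm x * norm (v n - y))).
  move=> n; apply: le_trans (ler_normD _ _) _.
  apply: lerD (normr_dot _ _); apply: le_trans (ler_normD _ _) _.
  by apply: lerD; exact: normr_dot.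
have -> : 0 = (0 : R) * 0 + 0 * norm y + norm x * 0.
  by rewrite !mulr0 mul0r !addr0.
apply: cvgD; last by apply: cvgM => //; exact: cvg_cst.
by apply: cvgD; apply: cvgM => //; exact: cvg_cst.
Qed.

Lemma dot_lim_eq u v u' v' x y x' y' : tends u x -> tends v y ->
  tends u' x' -> tends v' y' ->
  (forall n, dot (u n) (v n) = dot (u' n) (v' n)) -> dot x y = dot x' y'.
Proof.
move=> ux vy ux' vy' e; have := cvg_dot ux vy; rewrite (funext e) => h.
by have := cvg_unique _ h (cvg_dot ux' vy'); apply.
Qed.

Lemma dot_lim_le u v u' v' x y x' y' : tends u x -> tends v y ->
  tends u' x' -> tends v' y' ->
  (forall n, dot (u n) (v n) <= dot (u' n) (v' n)) -> dot x y <= dot x' y'.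
Proof.
move=> ux vy ux' vy' e.
have h := cvg_dot ux vy; have h' := cvg_dot ux' vy'.
by apply: (ler_cvg_to h h'); near=> n.
Unshelve. all: by end_near. Qed.

Definition is_subspace S := S 0 /\ forall a x y, S x -> S y -> S (a *: x + y).

Lemma subspaceB S x y : is_subspace S -> S x -> S y -> S (x - y).
Proof. by case=> _ h Sx Sy; rewrite addrC -scaleN1r; apply: h. Qed.
Lemma subspaceZ S a x : is_subspace S -> S x -> S (a *: x).
Proof. by case=> S0 h Sx; rewrite -[_ *: _]addr0; apply: h. Qed.
Lemma subspaceD S x y : is_subspace S -> S x -> S y -> S (x + y).
Proof. by case=> _ h Sx Sy; rewrite -[x]scale1r; apply: h. Qed.

Definition hclosure S : set H :=
  [set x | exists2 u, forall n, S (u n) & tends u x].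
Definition hclosed S := hclosure S `<=` S.

Lemma hclosureP S x : (forall e, 0 < e -> exists2 y, S y & norm (x - y) < e) ->
  hclosure S x.
Proof.
move=> h.
have /choice[u hu] : forall n : nat, exists y, S y /\ norm (x - y) < n.+1%:R^-1.
  by move=> n; have [|y Sy hy] := h n.+1%:R^-1; [rewrite invr_gt0|exists y].
exists u => [n|]; first by case: (hu n).
apply: (@squeeze0 _ (fun n => n.+1%:R^-1)); last exact: cvg_harmonic.
by move=> n; rewrite ger0_norm ?norm_ge0 // normBC ltW //; case: (hu n).
Qed.

Lemma hclosure_near S x : hclosure S x ->
  forall e, 0 < e -> exists2 y, S y & norm (x - y) < e.
Proof.
move=> [u Su /cvgrPdist_lt ux] e e0; have [N _ hN] := ux _ e0.
exists (u N) => //; have := hN N (leqnn N).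
by rewrite /= sub0r normrN normBC ger0_norm // norm_ge0.
Qed.

Lemma subset_hclosure S : S `<=` hclosure S.
Proof. by move=> x Sx; exists (fun=> x) => //; apply: tends_cst. Qed.

Lemma hclosure_closed S : hclosed (hclosure S).
Proof.
move=> x /hclosure_near h; apply: hclosureP => e e0.
have [y /hclosure_near Sy xy] := h (e / 2) ltac:(lra).
have [z Sz yz] := Sy (e / 2) ltac:(lra).
exists z => //; have -> : x - z = (x - y) + (y - z) by rewrite addrA subrK.
by apply: le_lt_trans (normD _ _) _; lra.
Qed.

Lemma hclosureS S G : S `<=` G -> hclosure S `<=` hclosure G.
Proof. by move=> h x [u Su ux]; exists u => // n; apply: h. Qed.

Lemma hclosure_subspace S : is_subspace S -> is_subspace (hclosure S).
Proof.
move=> SS; split; first by apply: subset_hclosure; case: SS.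
move=> a x y [u Su ux] [v Sv vy]; exists (fun n => a *: u n + v n).
  by move=> n; case: SS => _; apply.
by apply: tendsD => //; apply: tendsZ.
Qed.

(** A minimizing sequence of the distance is Cauchy by the parallelogram law,
    since the midpoint of two of its terms is also in G; moving the minimizer
    along g cannot decrease the distance, which is orthogonality. *)
Lemma projection G h : is_subspace G -> hclosed G ->
  exists2 p, G p & forall g, G g -> dot (h - p) g = 0.
Proof.
move=> GS Gc.
pose E := [set norm (h - g) ^+ 2 | g in G].
have E0 : lbound E 0 by move=> _ [g _ <-]; rewrite sqr_ge0.
have hE : has_inf E.
  by split; [exists (norm (h - 0) ^+ 2); exists 0 => //; case: GS|exists 0].
set d := inf E.
have dle g : G g -> d <= dot (h - g) (h - g).
  by move=> Gg; rewrite -norm_sqr; apply: ge_inf; [case: hE|exists g].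
have /choice[u hu] : forall n : nat, exists g,
    G g /\ dot (h - g) (h - g) < d + n.+1%:R^-1.
  move=> n; have [|_ [g Gg <-] lt] := @inf_adherent _ E (n.+1%:R^-1) _ hE.
    by rewrite invr_gt0.
  by exists g; rewrite -norm_sqr.
have [|p up] := @tends_complete u.
  move=> e e0.
  have [N _ /(_ N (leqnn N)) /= hN] :
      \forall n \near \oo, n.+1%:R^-1 < e ^+ 2 / 4.
    have e4 : 0 < e ^+ 2 / 4 by rewrite divr_gt0 ?exprn_gt0.
    have /cvgrPdist_lt /(_ _ e4) := @cvg_harmonic R.
    by apply: filterS => n; rewrite /= sub0r normrN ger0_norm // invr_ge0.
  have small n : (N <= n)%N -> dot (h - u n) (h - u n) < d + e ^+ 2 / 4.
    move=> Nn; have [_ hn] := hu n; apply: lt_le_trans hn _.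
    rewrite lerD2l; apply: le_trans (ltW hN).
    by rewrite lef_pV2 ?posrE // ler_nat.
  exists N => m n Nm Nn; rewrite norm_lt ?ltW //.
  have Gmid : G (2^-1 *: (u m + u n)).
    apply: subspaceZ => //.
    by apply: subspaceD => //; [case: (hu m)|case: (hu n)].
  have := dle _ Gmid; have := small _ Nm; have := small _ Nn.
  rewrite !dotE (dotC (u m) h) (dotC (u n) h) (dotC (u n) (u m)) => h1 h2 h3.
  lra.
have Gp : G p by apply: Gc; exists u => // n; case: (hu n).
have pd : dot (h - p) (h - p) <= d.
  apply/ler_addgt0Pl => e e0.
  have [_ [g Gg <-] _] := inf_adherent e0 hE.
  have hup : tends (fun n => h - u n) (h - p).
    by apply: tendsD; [exact: tends_cst|apply: tendsN].
  have c := cvg_dot hup hup.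
  have : (fun n : nat => d + n.+1%:R^-1) @ \oo --> d + 0.
    by apply: cvgD; [exact: cvg_cst|exact: cvg_harmonic].
  rewrite addr0 => /(ler_cvg_to c) le; apply: le_trans (le _) _; last by lra.
  by near=> n; rewrite ltW //; case: (hu n).
exists p => // g Gg; apply/eqP/negPn/negP => gN0.
have gp : 0 < dot g g.
  rewrite lt_neqAle dot_ge0 andbT eq_sym; apply: contra gN0 => /eqP/dot_eq0->.
  by rewrite dot0r.
pose t := dot (h - p) g / dot g g.
have := dle (p + t *: g) (subspaceD GS Gp (subspaceZ _ GS Gg)).
have -> : h - (p + t *: g) = (h - p) - t *: g by rewrite opprD addrA.
have tt : t * dot g g = dot (h - p) g by rewrite /t divfK // gt_eqF.
rewrite (dotBl (h - p)) !(dotBr _ _ (h - p)) (dotBr _ _ (t *: g)) !dotZr !dotZl.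
rewrite (dotC g (h - p)) tt => k.
have : 0 < t * dot (h - p) g.
  have tN0 : t != 0 by rewrite mulf_neq0 // invr_neq0 // gt_eqF.
  rewrite -tt mulrA -expr2 mulr_gt0 // lt_neqAle sqr_ge0 andbT eq_sym.
  by rewrite expf_neq0.
move: k pd; rewrite (dotBr _ _ (h - p)); lra.
Unshelve. all: by end_near. Qed.

(** Otherwise g minus its projection to the closure of S is a nonzero vector of
    G orthogonal to S. *)
Lemma dense_perp S G :
  is_subspace S -> is_subspace G -> hclosed G -> S `<=` G ->
  (forall g, G g -> (forall s, S s -> dot g s = 0) -> g = 0) ->
  G `<=` hclosure S.
Proof.
move=> SS GS Gc SG perp g Gg.
have [p Sp hp] := projection g (hclosure_subspace SS) (@hclosure_closed S).
have Gp : G p by apply: Gc; apply: hclosureS Sp.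
suff /eqP : g - p = 0 by rewrite subr_eq0 => /eqP ->.
apply: perp => [|s Ss]; first exact: subspaceB.
by apply: hp; apply: subset_hclosure.
Qed.

End Geometry.

(** * Square roots of bounded positive operators *)

Section SquareRoot.
Variables (R : realType) (H : hilbert R).
Implicit Types (x y z : H) (A B C U V : H -> H).

(** A map defined everywhere that has an adjoint is automatically linear and
    commutes with limits in the weak sense.  This one notion thus replaces
    boundedness: [adjoint_pair A A] says that A is bounded and symmetric. *)
Definition adjoint_pair U V := forall x y, dot (U x) y = dot x (V y).
Definition positive_op A := adjoint_pair A A /\ forall x, 0 <= dot (A x) x.
Definition contraction A := forall x, dot (A x) x <= dot x x.

Lemma adj_lin U V : adjoint_pair U V ->
  forall a x y, U (a *: x + y) = a *: U x + U y.
Proof. by move=> h a x y; apply: dot_inj => z; rewrite h !dotP !h. Qed.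
Lemma adjD U V : adjoint_pair U V -> forall x y, U (x + y) = U x + U y.
Proof. by move=> h x y; have := adj_lin h 1 x y; rewrite !scale1r. Qed.
Lemma adj0 U V : adjoint_pair U V -> U 0 = 0.
Proof. by move=> h; apply: dot_inj => z; rewrite h !dot0l. Qed.
Lemma adjZ U V : adjoint_pair U V -> forall a x, U (a *: x) = a *: U x.
Proof. by move=> h a x; apply: dot_inj => z; rewrite h !dotZl h. Qed.
Lemma adjB U V : adjoint_pair U V -> forall x y, U (x - y) = U x - U y.
Proof. by move=> h x y; apply: dot_inj => z; rewrite h !dotBl !h. Qed.

(** This is A^2 <= A for 0 <= A <= 1, from
    A - A^2 = A (1 - A) A + (1 - A) A (1 - A). *)
Lemma positive_sqr_le A : positive_op A -> contraction A ->
  forall x, dot (A x) (A x) <= dot (A x) x.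
Proof.
move=> [As Ap] A1 x; have := A1 (A x); have := Ap (x - A x).
rewrite (adjB As) !dotBl !dotBr (As (A x) x); lra.
Qed.

Section Iteration.
Variables (B : H -> H).
Hypotheses (Bp : positive_op B) (B1 : contraction B).

Let A x := x - B x.
(** With A = 1 - B, a fixed point Y of Y |-> (A + Y^2) / 2 satisfies
    (1 - Y)^2 = B.  The same iteration on numbers, with 1 in place of A, bounds
    the norms of the iterates and of their differences. *)
Fixpoint sqrt_iter n x :=
  if n is n'.+1 then 2^-1 *: (A x + sqrt_iter n' (sqrt_iter n' x)) else 0.
Local Notation Y := sqrt_iter.
Fixpoint sqrt_bound n : R :=
  if n is n'.+1 then 2^-1 * (1 + sqrt_bound n' ^+ 2) else 0.
Local Notation b := sqrt_bound.

Lemma sqrt_iterS n x : Y n.+1 x = 2^-1 *: (A x + Y n (Y n x)).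
Proof. by []. Qed.

Lemma sqrt_boundS n : b n.+1 = 2^-1 * (1 + b n ^+ 2).
Proof. by []. Qed.

Lemma sqrt_bound_itv n : 0 <= b n <= 1.
Proof.
elim: n => [|n /andP[h0 h1]] /=; first by rewrite lexx ler01.
by apply/andP; split; nra.
Qed.

Lemma sqrt_bound_incr n : b n <= b n.+1.
Proof. by have := sqr_ge0 (1 - b n); rewrite /=; nra. Qed.

Lemma sqrt_defect_sym : adjoint_pair A A.
Proof. by move=> x y; case: Bp => Bs _; rewrite /A dotBl dotBr Bs. Qed.

Lemma sqrt_defect_norm x : norm (A x) <= norm x.
Proof.
rewrite /norm ler_wsqrtr // (_ : dot _ _ =
  dot x x - 2 * dot (B x) x + dot (B x) (B x)).
  by case: (Bp) => _ /(_ x) h; have := positive_sqr_le Bp B1 x; lra.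
by rewrite /A !dotBl !dotBr (dotC x (B x)); ring.
Qed.

Lemma iter_sym n : adjoint_pair (Y n) (Y n).
Proof.
elim: n => [|n IH] x y /=; first by rewrite dot0l dot0r.
by rewrite dotZl dotZr dotDl dotDr sqrt_defect_sym !IH.
Qed.

Lemma iter_comm U V n : adjoint_pair U V -> (forall x, U (B x) = B (U x)) ->
  forall x, U (Y n x) = Y n (U x).
Proof.
move=> UV UB; elim: n => [|n IH] x /=; first exact: (adj0 UV).
by rewrite (adjZ UV) (adjD UV) /A (adjB UV) UB !IH.
Qed.

Lemma iter_comm2 m n x : Y m (Y n x) = Y n (Y m x).
Proof.
apply: iter_comm (iter_sym m) _ _ => {}x.
by rewrite -(iter_comm _ (proj1 Bp)).
Qed.

Lemma iter_norm n x : norm (Y n x) <= b n * norm x.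
Proof.
elim: n x => [|n IH] x /=; first by rewrite norm0 mul0r.
have /andP[b0 _] := sqrt_bound_itv n.
rewrite normZ ger0_norm ?invr_ge0 // -mulrA ler_pM2l ?invr_gt0 //.
apply: le_trans (normD _ _) _; rewrite mulrDl mul1r lerD ?sqrt_defect_norm //.
by apply: le_trans (IH _) _; rewrite expr2 -mulrA ler_wpM2l.
Qed.

(** By commutativity the difference of the squares of two consecutive iterates
    is their difference composed with their sum, exactly as for the scalar
    bounds. *)
Lemma iter_step n x :
  norm (Y n.+1 x - Y n x) <= (b n.+1 - b n) * norm x.
Proof.
elim: n x => [|n IH] x.
  by rewrite subr0; apply: le_trans (iter_norm 1 x) _; rewrite subr0.
have -> : Y n.+2 x - Y n.+1 x = 2^-1 *: (Y n.+1 (Y n.+1 x + Y n x) -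
    Y n (Y n.+1 x + Y n x)).
  rewrite (sqrt_iterS n.+1) [X in _ - X = _](sqrt_iterS n) -scalerBr.
  congr (_ *: _).
  rewrite !(adjD (iter_sym _)) (iter_comm2 n.+1 n).
  move: (Y n.+1 _) (Y n (Y n.+1 _)) (Y n (Y n _)) (A x) => p q r a.
  by rewrite opprD addrACA subrr add0r opprD addrA addrK.
rewrite normZ ger0_norm ?invr_ge0 //.
have -> : b n.+2 - b n.+1 = 2^-1 * ((b n.+1 - b n) * (b n.+1 + b n)).
  by rewrite (sqrt_boundS n.+1) [X in _ - X = _](sqrt_boundS n); ring.
rewrite -mulrA ler_pM2l ?invr_gt0 //.
apply: le_trans (IH _) _; rewrite -mulrA ler_wpM2l //.
  by rewrite subr_ge0 sqrt_bound_incr.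
by apply: le_trans (normD _ _) _; rewrite mulrDl lerD ?iter_norm.
Qed.

Lemma iter_dist n k x :
  norm (Y (n + k) x - Y n x) <= (b (n + k) - b n) * norm x.
Proof.
elim: k => [|k IH]; first by rewrite addn0 !subrr norm0 mul0r.
rewrite addnS; have -> : Y (n + k).+1 x - Y n x =
  (Y (n + k).+1 x - Y (n + k) x) + (Y (n + k) x - Y n x) by rewrite addrA subrK.
apply: le_trans (normD _ _) _.
have := iter_step (n + k) x; set c := b _.+1; nra.
Qed.

Lemma sqrt_bound_cauchy e : 0 < e -> exists N, forall k, b (N + k) - b N < e.
Proof.
move=> e0; pose E := range b.
have hE : has_sup E.
  split; first by exists (b 0), 0.
  by exists 1 => _ [n _ <-]; case/andP: (sqrt_bound_itv n).
have [_ [N _ <-] hN] := sup_adherent e0 hE; exists N => k.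
have : b (N + k) <= sup E by apply: ub_le_sup; [case: hE|exists (N + k)%N].
lra.
Qed.

Lemma iter_cvg x : exists y, tends (fun n => Y n x) y.
Proof.
apply: tends_complete => e e0; pose c := norm x + 1.
have c0 : 0 < c by have := norm_ge0 x; rewrite /c; lra.
have [N hN] := @sqrt_bound_cauchy (e / (2 * c)) ltac:(by apply: divr_gt0; lra).
have near n : (N <= n)%N -> norm (Y n x - Y N x) < e / 2.
  move=> /subnKC <-; apply: le_lt_trans (iter_dist _ _ _) _.
  apply: (@le_lt_trans _ _ (e / (2 * c) * norm x)).
    by rewrite ler_wpM2r ?norm_ge0 // ltW.
  rewrite (_ : e / 2 = e / (2 * c) * c); last by field; rewrite gt_eqF.
  by rewrite ltr_pM2l ?divr_gt0 ?mulr_gt0 // /c; lra.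
exists N => m n Nm Nn.
have -> : Y m x - Y n x = (Y m x - Y N x) + (Y N x - Y n x).
  by rewrite addrA subrK.
apply: le_lt_trans (normD _ _) _; rewrite (normBC (Y N x)).
by have := near _ Nm; have := near _ Nn; lra.
Qed.

End Iteration.

(** That C commutes with all that commutes with B is the essential clause: it
    provides the commutations that the construction of the modulus needs and
    that [sqrt_unique] asks for. *)
Lemma sqrt_exists B : positive_op B -> contraction B -> exists C,
  [/\ positive_op C, contraction C, forall x, C (C x) = B x &
   forall U V, adjoint_pair U V -> (forall x, U (B x) = B (U x)) ->
     forall x, U (C x) = C (U x)].
Proof.
move=> Bp B1; have /choice[Y hY] := iter_cvg Bp B1.
have Ys : adjoint_pair Y Y.
  move=> x y; apply: (dot_lim_eq (hY x) (tends_cst y) (tends_cst x) (hY y)).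
  by move=> n; apply: iter_sym.
have Yn x : dot (Y x) (Y x) <= dot x x.
  apply: (dot_lim_le (hY x) (hY x) (tends_cst x) (tends_cst x)) => n.
  rewrite -!norm_sqr ler_sqr ?nnegrE ?norm_ge0 //.
  apply: le_trans (iter_norm Bp B1 _ _) _; rewrite ler_piMl ?norm_ge0 //.
  by case/andP: (sqrt_bound_itv n).
have YY x : Y (Y x) = 2 *: Y x - (x - B x).
  apply: dot_inj => z; rewrite Ys.
  have Y1 : tends (fun n => sqrt_iter B n.+1 x) (Y x).
    by have := hY x; rewrite /tends -cvg_shiftS.
  apply: (dot_lim_eq (hY x) (hY z) _ (tends_cst z)).
    by apply: tendsD (tendsZ 2 Y1) _; apply: tends_cst.
  move=> n /=; rewrite scalerA divff // scale1r addrAC subrr add0r.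
  by apply/esym/(iter_sym Bp).
pose C x := x - Y x.
have CC x : C (C x) = B x.
  rewrite /C (adjB Ys) YY; apply: dot_inj => z; rewrite !dotE; ring.
have Cs : adjoint_pair C C by move=> x y; rewrite /C dotBl dotBr Ys.
exists C; split => //.
- split=> // x; rewrite /C dotBl; have := dot_sqr_le (Y x) x; have := Yn x.
  have := dot_ge0 x; have := dot_ge0 (x - Y x).
  by rewrite !dotE (dotC x (Y x)); nra.
- move=> x; have := B1 x; rewrite -CC Cs; move: (C x) => c.
  have := dot_ge0 (x - c).
  by rewrite !dotBl !dotBr (dotC x c); lra.
- move=> U V UV UB x; rewrite /C (adjB UV); congr (_ - _).
  apply: dot_inj => z; rewrite UV.
  apply: (dot_lim_eq (hY x) (tends_cst _) (hY (U x)) (tends_cst z)) => n.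
  by rewrite -UV (iter_comm _ UV UB).
Qed.

Lemma positive_kernel C : positive_op C -> contraction C ->
  forall x, dot (C x) x = 0 -> C x = 0.
Proof.
move=> Cp C1 x h; apply: dot_eq0; apply/eqP.
by rewrite eq_le dot_ge0 -h positive_sqr_le.
Qed.

(** With y = (C - C') x, commutation gives (C + C') y = (C^2 - C'^2) x = 0, so
    both <C y, y> and <C' y, y> vanish, hence C y = C' y = 0, and finally
    |(C - C') x|^2 = <(C - C') y, x> = 0. *)
Lemma sqrt_unique C C' : positive_op C -> contraction C ->
  positive_op C' -> contraction C' ->
  (forall x, C (C x) = C' (C' x)) -> (forall x, C' (C x) = C (C' x)) ->
  forall x, C x = C' x.
Proof.
move=> Cp C1 Cp' C1' E comm x; have [Cs C0] := Cp; have [Cs' C0'] := Cp'.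
pose y := C x - C' x.
have h : C y + C' y = 0.
  rewrite /y (adjB Cs) (adjB Cs') E comm addrA subrK subrr //.
have s : dot (C y) y + dot (C' y) y = 0 by rewrite -dotDl h dot0l.
have h1 := C0 y; have h2 := C0' y.
have Cy : C y = 0 by apply: positive_kernel => //; lra.
have Cy' : C' y = 0 by apply: positive_kernel => //; lra.
apply/eqP; rewrite -subr_eq0 -/y; apply/eqP/dot_eq0.
by rewrite {2}/y dotBr -Cs -Cs' Cy Cy' !dot0l subrr.
Qed.

End SquareRoot.

(** * Operators as graphs *)

Section ProductHilbert.
Variables (R : realType) (H1 H2 : hilbert R).
Let pdot (p q : (H1 * H2)%type) : R := dot p.1 q.1 + dot p.2 q.2.

Lemma pdotC p q : pdot p q = pdot q p.
Proof. by rewrite /pdot dotC (dotC p.2). Qed.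
Lemma pdotP a p q r : pdot (a *: p + q) r = a * pdot p r + pdot q r.
Proof. by rewrite /pdot !dotP; ring. Qed.
Lemma pdot_ge0 p : 0 <= pdot p p.
Proof. by rewrite addr_ge0 ?dot_ge0. Qed.
Lemma pdot_eq0 p : pdot p p = 0 -> p = 0.
Proof.
case: p => x y; rewrite /pdot /= => h; have := dot_ge0 x; have := dot_ge0 y.
by move=> hy hx; congr pair; apply: dot_eq0; lra.
Qed.
Lemma pdot_complete (u : nat -> (H1 * H2)%type) :
  (forall e, 0 < e -> exists N, forall m n, (N <= m)%N -> (N <= n)%N ->
     pdot (u m - u n) (u m - u n) < e) ->
  exists l, forall e, 0 < e -> exists N, forall n, (N <= n)%N ->
     pdot (u n - l) (u n - l) < e.
Proof.
move=> h.
have [|x hx] := @dot_complete _ H1 (fun n => (u n).1).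
  move=> e /h[N hN]; exists N => m n Nm Nn; have := hN m n Nm Nn.
  by rewrite /pdot /=; have := dot_ge0 ((u m).2 - (u n).2); lra.
have [|y hy] := @dot_complete _ H2 (fun n => (u n).2).
  move=> e /h[N hN]; exists N => m n Nm Nn; have := hN m n Nm Nn.
  by rewrite /pdot /=; have := dot_ge0 ((u m).1 - (u n).1); lra.
exists (x, y) => e e0; have e2 : 0 < e / 2 by lra.
have [M hM] := hx _ e2; have [N hN] := hy _ e2.
exists (maxn M N) => n; rewrite geq_max => /andP[/hM h1 /hN h2].
by rewrite /pdot /=; lra.
Qed.
Definition prod_hilbert : hilbert R :=
  Hilbert pdotC pdotP pdot_ge0 pdot_eq0 pdot_complete.

Lemma prod_dotE (p q : prod_hilbert) : dot p q = dot p.1 q.1 + dot p.2 q.2.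
Proof. by []. Qed.

Lemma norm_fst (p : prod_hilbert) : norm p.1 <= norm p.
Proof. by rewrite /norm ler_wsqrtr // prod_dotE lerDl dot_ge0. Qed.
Lemma norm_snd (p : prod_hilbert) : norm p.2 <= norm p.
Proof. by rewrite /norm ler_wsqrtr // prod_dotE lerDr dot_ge0. Qed.
Lemma norm_prod_le (p : prod_hilbert) : norm p <= norm p.1 + norm p.2.
Proof.
rewrite norm_le ?addr_ge0 ?norm_ge0 // prod_dotE sqrrD !norm_sqr.
have := mulr_ge0 (norm_ge0 p.1) (norm_ge0 p.2); lra.
Qed.

Lemma tends_fst (u : nat -> prod_hilbert) p :
  tends u p -> tends (fun n => (u n).1) p.1.
Proof.
apply: squeeze0 => n; rewrite ger0_norm ?norm_ge0 //.
exact: (norm_fst (u n - p)).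
Qed.
Lemma tends_snd (u : nat -> prod_hilbert) p :
  tends u p -> tends (fun n => (u n).2) p.2.
Proof.
apply: squeeze0 => n; rewrite ger0_norm ?norm_ge0 //.
exact: (norm_snd (u n - p)).
Qed.
Lemma tends_pair (u : nat -> H1) (v : nat -> H2) x y : tends u x -> tends v y ->
  @tends _ prod_hilbert (fun n => (u n, v n)) (x, y).
Proof.
move=> ux vy.
apply: (@squeeze0 _ _ (fun n => norm (u n - x) + norm (v n - y))).
  move=> n; rewrite ger0_norm ?norm_ge0 //; exact: norm_prod_le.
by rewrite -[0]addr0; apply: cvgD.
Qed.

End ProductHilbert.

Section Graphs.
Variables (R : realType) (H : hilbert R).
Local Notation HH := (prod_hilbert H H).
Implicit Types (G M : set HH) (B C T : H -> H) (f g h u v : H).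

(** Density of the domain is expressed by its orthogonal complement. *)
Definition dense_domain G :=
  forall h, (forall f g, G (f, g) -> dot h f = 0) -> h = 0.
Definition univalent G := forall g, G (0, g) -> g = 0.
Definition selfadjoint_graph G :=
  forall u v, G (u, v) <-> forall f g, G (f, g) -> dot g u = dot f v.
Definition nonneg_graph G := forall f g, G (f, g) -> 0 <= dot g f.
(** Equal domains and | G f | = | M f |, that is, G*G = M*M. *)
Definition same_modulus G M := [/\ forall f g, G (f, g) -> exists v, M (f, v),
  forall f v, M (f, v) -> exists g, G (f, g) &
  forall f g v, G (f, g) -> M (f, v) -> norm g = norm v].

Lemma graphB G f g u v : is_subspace G ->
  G (f, g) -> G (u, v) -> G (f - u, g - v).
Proof. by move=> GS /(subspaceB GS) h /h. Qed.
Lemma graphD G f g u v : is_subspace G ->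
  G (f, g) -> G (u, v) -> G (f + u, g + v).
Proof. by move=> GS /(subspaceD GS) h /h. Qed.

Lemma univalentP G f g v : is_subspace G -> univalent G ->
  G (f, g) -> G (f, v) -> g = v.
Proof.
move=> GS Gu /(graphB GS) Gg /Gg; rewrite subrr => /Gu/eqP.
by rewrite subr_eq0 => /eqP.
Qed.

(** Isometry turns a sequence whose images under the first operator converge
    into one whose images under the second are Cauchy. *)
Lemma isometric_closure (Z : H -> H -> H -> Prop) M : hclosed M ->
  (forall f g v, Z f g v -> M (f, v) /\ norm g = norm v) ->
  (forall f g v f' g' v', Z f g v -> Z f' g' v' ->
     norm (g - g') = norm (v - v')) ->
  forall f g, hclosure [set p : HH | exists v, Z p.1 p.2 v] (f, g) ->
  exists2 v, M (f, v) & norm g = norm v.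
Proof.
move=> Mc ZM Ziso f g [w Zw wfg].
have /choice[q hq] := Zw.
have [|v qv] := @tends_complete _ H q.
  move=> e e0; have [N hN] := tends_cauchy (tends_snd wfg) e0.
  by exists N => m n Nm Nn; rewrite -(Ziso _ _ _ _ _ _ (hq m) (hq n)) hN.
exists v.
  apply: Mc; exists (fun n => ((w n).1, q n)).
    by move=> n; case: (ZM _ _ _ (hq n)).
  exact: (tends_pair (tends_fst wfg) qv).
apply: norm_eq; apply: (dot_lim_eq (tends_snd wfg) (tends_snd wfg) qv qv) => n.
by rewrite -!norm_sqr; case: (ZM _ _ _ (hq n)) => _ ->.
Qed.

Lemma same_modulus_closure (Z : H -> H -> H -> Prop) G M :
  is_subspace G -> hclosed G -> univalent G ->
  is_subspace M -> hclosed M -> univalent M ->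
  (forall f g v, Z f g v -> [/\ G (f, g), M (f, v) & norm g = norm v]) ->
  (forall f g v f' g' v', Z f g v -> Z f' g' v' ->
     norm (g - g') = norm (v - v')) ->
  G `<=` hclosure [set p : HH | exists v, Z p.1 p.2 v] ->
  M `<=` hclosure [set p : HH | exists g, Z p.1 g p.2] ->
  same_modulus G M.
Proof.
move=> GS Gc Gu MS Mc Mu ZGM Ziso GZ MZ.
have GM f g : G (f, g) -> exists2 v, M (f, v) & norm g = norm v.
  move=> /GZ; apply: isometric_closure Mc _ Ziso _ _ => {}f {}g v.
  by case/ZGM.
split=> [f g /GM[v]|f v /MZ|f g v Gg Mv]; first by exists v.
  move=> h; have [] := @isometric_closure (fun f v g => Z f g v) G Gc _ _ _ _ h.
  - by move=> {h}f {}v g /ZGM[].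
  - by move=> {h}f {}v g f' v' g' z z'; apply/esym/(Ziso f _ _ f').
  - by move=> g; exists g.
by have [v' Mv' ->] := GM _ _ Gg; rewrite (univalentP MS Mu Mv' Mv).
Qed.

(** Polarization, in the form |g - g'|^2 = |v - v'|^2. *)
Lemma same_modulus_dot G M :
  is_subspace G -> is_subspace M -> same_modulus G M ->
  forall f g v f' g' v', G (f, g) -> M (f, v) -> G (f', g') -> M (f', v') ->
  dot g g' = dot v v'.
Proof.
move=> GS MS [_ _ iso] f g v f' g' v' Gg Mv Gg' Mv'.
have e := iso _ _ _ Gg Mv; have e' := iso _ _ _ Gg' Mv'.
have := iso _ _ _ (graphB GS Gg Gg') (graphB MS Mv Mv').
move=> /(congr1 (fun x => x ^+ 2)); rewrite !norm_sqr !dotBl !dotBr.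
by rewrite -!norm_sqr e e' (dotC g' g) (dotC v' v); lra.
Qed.

(** A core of G is a core of every operator with the same modulus, since the
    graph norms coincide. *)
Lemma core_transfer G M (D : set HH) : is_subspace G -> is_subspace M ->
  same_modulus G M -> D `<=` G -> G `<=` hclosure D ->
  M `<=` hclosure [set p : HH | M p /\ exists g, D (p.1, g)].
Proof.
move=> GS MS [GM MG iso] DG GD [f v] Mfv.
have [g Gg] := MG _ _ Mfv; apply: hclosureP => e e0.
have [[f' g'] Dg' near] := hclosure_near (GD _ Gg) e0.
have Gg' := DG _ Dg'; have [v' Mv'] := GM _ _ Gg'.
exists (f', v'); first by split => //; exists g'.
have := iso _ _ _ (graphB GS Gg Gg') (graphB MS Mfv Mv') => E.
apply: le_lt_trans near; rewrite norm_le ?norm_ge0 // norm_sqr !prod_dotE /=.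
by rewrite -!(norm_sqr (_ - _)) E.
Qed.

(** (B h, T h) is the orthogonal projection of (h, 0) onto G; for the graph of
    an operator A this means B = (1 + A*A)^-1 and T = A B. *)
Definition resolvent G B T := forall h, G (B h, T h) /\
  forall f g, G (f, g) -> dot (h - B h) f = dot (T h) g.

Lemma resolvent_exists G : is_subspace G -> hclosed G ->
  exists B T, resolvent G B T.
Proof.
move=> GS Gc.
have /choice[P hP] : forall h, exists p : HH, G p /\
    forall f g, G (f, g) -> dot (h - p.1) f = dot p.2 g.
  move=> h; have [p Gp hp] := @projection _ HH G (h, 0) GS Gc.
  exists p; split=> // f g Gg; have := hp _ Gg.
  by rewrite prod_dotE /= sub0r dotNl => /eqP; rewrite subr_eq0 => /eqP.
exists (fun h => (P h).1), (fun h => (P h).2) => h.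
by have [Gp hp] := hP h; split => //; rewrite -surjective_pairing.
Qed.

Section Resolvent.
Variables (G : set HH) (B T : H -> H).
Hypotheses (GS : is_subspace G) (GB : resolvent G B T).

Lemma res_dot h f g : G (f, g) -> dot h f = dot (B h) f + dot (T h) g.
Proof. by move=> Gg; have [_ /(_ _ _ Gg)] := GB h; rewrite dotBl; lra. Qed.

Lemma res_unique h u w : G (u, w) ->
  (forall f g, G (f, g) -> dot h f = dot u f + dot w g) -> u = B h /\ w = T h.
Proof.
move=> Gu hu; have Gd := graphB GS Gu (proj1 (GB h)).
have := hu _ _ Gd; rewrite (res_dot h Gd) => E.
have {}E : dot (u - B h) (u - B h) + dot (w - T h) (w - T h) = 0.
  by rewrite dotBl (dotBl w); lra.
have h1 := dot_ge0 (u - B h); have h2 := dot_ge0 (w - T h).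
split; apply/eqP; rewrite -subr_eq0; apply/eqP/dot_eq0; lra.
Qed.

Lemma res_sym : adjoint_pair B B.
Proof.
move=> h k; rewrite (res_dot h (proj1 (GB k))) dotC.
by rewrite (res_dot k (proj1 (GB h))) (dotC (B h)) (dotC (T h)).
Qed.

Lemma res_dotB h : dot (B h) h = dot (B h) (B h) + dot (T h) (T h).
Proof. by rewrite dotC (res_dot h (proj1 (GB h))). Qed.

Lemma res_positive : positive_op B.
Proof.
by split; [exact: res_sym|move=> h; rewrite res_dotB addr_ge0 ?dot_ge0].
Qed.

Lemma res_contraction : contraction B.
Proof.
move=> h; have := dot_ge0 (h - B h); have := res_dotB h.
by have := dot_ge0 (T h); rewrite !dotBl !dotBr (dotC h); lra.
Qed.

Lemma res_inj h : dense_domain G -> B h = 0 -> h = 0.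
Proof.
move=> Gd Bh; apply: Gd => f g Gg; rewrite (res_dot h Gg).
have := res_dotB h; rewrite Bh !dot0l add0r => /esym/dot_eq0 ->.
by rewrite !dot0l addr0.
Qed.

Lemma res_linear a h k : B (a *: h + k) = a *: B h + B k /\
  T (a *: h + k) = a *: T h + T k.
Proof.
have [||-> ->] := @res_unique (a *: h + k) (a *: B h + B k) (a *: T h + T k).
- by case: GS => _ h2; apply: (h2 a (_, _) (_, _)); case: (GB h); case: (GB k).
- move=> f g Gg; rewrite !dotP (res_dot h Gg) (res_dot k Gg); ring.
by [].
Qed.

(** The range of B is a core: a vector (f, g) of G that is orthogonal to the
    projections of all (h, 0) is orthogonal to all (h, 0), so f = 0. *)
Lemma res_dense : hclosed G -> univalent G ->
  G `<=` hclosure [set p : HH | exists h, p = (B h, T h)].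
Proof.
move=> Gc Gu; apply: dense_perp => //.
- split; first by exists 0; have [||<- <-] := @res_unique 0 0 0;
    [case: GS|move=> *; rewrite !dot0l addr0|by []].
  move=> a _ _ [h ->] [k ->]; exists (a *: h + k).
  by case: (res_linear a h k) => -> ->.
- by move=> _ [h ->]; case: (GB h).
move=> [f g] Gg perp; suff f0 : f = 0.
  by rewrite f0 in Gg *; rewrite (Gu _ Gg).
apply: dot_inj => h; rewrite dot0l dotC (res_dot h Gg).
by have := perp _ (ex_intro _ h erefl); rewrite prod_dotE /= (dotC f) (dotC g).
Qed.

Lemma res_comm U V : adjoint_pair U V ->
  (forall f g, G (f, g) -> G (U f, U g)) ->
  (forall f g, G (f, g) -> G (V f, V g)) ->
  forall h, U (B h) = B (U h).
Proof.
move=> UV GU GV h; apply: (proj1 (@res_unique (U h) (U (B h)) (U (T h)) _ _)).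
  by apply: GU; case: (GB h).
by move=> f g Gg; rewrite !UV (res_dot h (GV _ _ Gg)).
Qed.

End Resolvent.

(** * The modulus of a closed operator *)

Section Modulus.
Variables (B C : H -> H).
Hypotheses (Bp : positive_op B) (Binj : forall h, B h = 0 -> h = 0).
Hypotheses (Cs : adjoint_pair C C) (CC : forall h, C (C h) = B h - B (B h)).
Hypotheses (BC : forall h, B (C h) = C (B h)).

(** When B = (1 + A*A)^-1 and C = |A| B, the pair (u, |A| u) satisfies
    C u = B |A| u because |A| and B commute; this equation is taken as the
    definition. *)
Definition modulus_graph : set HH := [set p | C p.1 = B p.2].

Lemma modulus_subspace : is_subspace modulus_graph.
Proof.
split=> [|a [f g] [u v]]; rewrite /modulus_graph /=.
  by rewrite (adj0 Cs) (adj0 (proj1 Bp)).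
by move=> h k; rewrite (adj_lin Cs) (adj_lin (proj1 Bp)) h k.
Qed.

Lemma modulus_closed : hclosed modulus_graph.
Proof.
move=> [f g] [w Mw wfg]; apply: dot_inj => z; rewrite Cs (proj1 Bp).
apply: (dot_lim_eq (tends_fst wfg) (tends_cst _) (tends_snd wfg) (tends_cst _)).
by move=> n; rewrite -Cs -(proj1 Bp) Mw.
Qed.

Lemma modulus_range h : modulus_graph (B h, C h).
Proof. by rewrite /modulus_graph /= BC. Qed.

Lemma modulus_univalent : univalent modulus_graph.
Proof. by move=> g; rewrite /modulus_graph /= (adj0 Cs) => /esym/Binj. Qed.

(** If (u, v) in the graph is orthogonal to all (B h, C h), then B u + C v = 0
    together with C u = B v gives
    0 = B (B u + C v) = B^2 u + C^2 u = B u, whence u = 0 and v = 0. *)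
Lemma modulus_dense :
  modulus_graph `<=` hclosure [set p : HH | exists h, p = (B h, C h)].
Proof.
have Bs := proj1 Bp.
apply: dense_perp (modulus_subspace) modulus_closed _ _ => [||[u v] Muv perp].
- split; first by exists 0; rewrite (adj0 Cs) (adj0 Bs).
  move=> a _ _ [h ->] [k ->]; exists (a *: h + k).
  by rewrite (adj_lin Cs) (adj_lin Bs).
- by move=> _ [h ->]; apply: modulus_range.
have BuCv : B u + C v = 0.
  apply: dot_inj => h; rewrite dot0l dotDl Bs Cs.
  by have := perp _ (ex_intro _ h erefl).
have u0 : u = 0.
  apply: Binj; have : B (B u + C v) = 0 by rewrite BuCv (adj0 Bs).
  by rewrite (adjD Bs) BC -Muv CC addrC subrK.
rewrite u0 in Muv *; rewrite (modulus_univalent Muv) //.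
Qed.

(** Testing against the pairs (B h, C h) shows that the adjoint is contained in
    the graph; the converse inclusion is symmetry, which passes from these dense
    pairs to the whole graph. *)
Lemma modulus_selfadj : selfadjoint_graph modulus_graph.
Proof.
have Bs := proj1 Bp.
have sym0 u v h : modulus_graph (u, v) -> dot (C h) u = dot (B h) v.
  by move=> Muv; rewrite Cs Bs Muv.
move=> u v; split=> [Muv f g /modulus_dense[w hw wfg]|h].
  apply: (dot_lim_eq (tends_snd wfg) (tends_cst u)
                     (tends_fst wfg) (tends_cst v)).
  by move=> n; have [k ->] := hw n; apply: sym0.
by apply: dot_inj => k; rewrite Cs Bs dotC (dotC v) (h _ _ (modulus_range k)).
Qed.

Lemma modulus_nonneg :
  (forall h, 0 <= dot (C h) (B h)) -> nonneg_graph modulus_graph.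
Proof.
move=> CB f g /modulus_dense[w hw wfg].
suff : dot (0 : H) (0 : H) <= dot g f by rewrite dot0l.
apply: (dot_lim_le (tends_cst _) (tends_cst _) (tends_snd wfg) (tends_fst wfg)).
by move=> n; have [k ->] := hw n; rewrite dot0l CB.
Qed.

End Modulus.

Lemma positive_defect B : positive_op B -> contraction B ->
  positive_op (fun h => B h - B (B h)) /\ contraction (fun h => B h - B (B h)).
Proof.
move=> Bp B1; have Bs := proj1 Bp; split.
  split=> [h k|h]; first by rewrite dotBl dotBr !Bs.
  by rewrite dotBl (Bs (B h)) subr_ge0 positive_sqr_le.
by move=> h; rewrite dotBl (Bs (B h)); have := B1 h; have := dot_ge0 (B h); lra.
Qed.

(** The last clause makes the modulus commute with every operator that preserves
    G together with its adjoint; for multiplication by i it says that the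
    modulus is complex linear. *)
Theorem modulus_exists G :
  is_subspace G -> hclosed G -> dense_domain G -> univalent G ->
  exists M, [/\ is_subspace M /\ hclosed M,
    selfadjoint_graph M /\ nonneg_graph M, same_modulus G M &
    forall U V, adjoint_pair U V -> (forall f g, G (f, g) -> G (U f, U g)) ->
      (forall f g, G (f, g) -> G (V f, V g)) ->
      forall f g, M (f, g) -> M (U f, U g)].
Proof.
move=> GS Gc Gd Gu; have [B [T GB]] := resolvent_exists GS Gc.
have Bp := res_positive GB; have Bs := proj1 Bp; have B1 := res_contraction GB.
have [Dp D1] := positive_defect Bp B1.
have [C [Cp C1 CC Ccomm]] := sqrt_exists Dp D1.
(* With E^2 = C and E commuting with B, <C h, B h> = <B E h, E h> >= 0. *)
have [E [Ep _ EE Ecomm]] := sqrt_exists Cp C1.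
have Cs := proj1 Cp; have Es := proj1 Ep.
have BC h : B (C h) = C (B h).
  by apply: (Ccomm _ _ Bs) => x; rewrite (adjB Bs).
have BE h : B (E h) = E (B h) by apply: (Ecomm _ _ Bs) => x; rewrite BC.
have Binj h : B h = 0 -> h = 0 by apply: res_inj.
exists (modulus_graph B C); split.
- split; [exact: modulus_subspace|exact: modulus_closed].
- split; first exact: modulus_selfadj.
  by apply: modulus_nonneg => // h; rewrite -EE Es -BE dotC; apply: (proj2 Bp).
- have iso h : norm (T h) = norm (C h).
    apply: norm_eq; rewrite Cs CC dotBr -Bs; have := res_dotB GB h.
    by rewrite (dotC h) -Bs; lra.
  apply: (@same_modulus_closure
    (fun f g v => exists h, [/\ f = B h, g = T h & v = C h])).
  + exact: GS.
  + exact: Gc.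
  + exact: Gu.
  + exact: modulus_subspace.
  + exact: modulus_closed.
  + exact: modulus_univalent.
  + move=> _ _ _ [h [-> -> ->]].
    by split; [case: (GB h)|exact: modulus_range|exact: iso].
  + move=> _ _ _ _ _ _ [h [_ -> ->]] [k [_ -> ->]].
    have TB : T (h - k) = T h - T k.
      have [_] := res_linear GS GB (-1) k h.
      by rewrite !scaleN1r ![- _ + _]addrC.
    by rewrite -(adjB Cs) -TB iso.
  + apply: subset_trans (res_dense GS GB Gc Gu) _; apply: hclosureS.
    by move=> _ [h ->]; exists (C h), h.
  + apply: subset_trans (modulus_dense Bp Binj Cs CC BC) _; apply: hclosureS.
    by move=> _ [h ->]; exists (T h), h.
- move=> U V UV GU GV f g; rewrite /modulus_graph /= => Mfg.
  have UB := res_comm GS GB UV GU GV.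
  rewrite -(Ccomm U V UV) ?Mfg ?UB //.
  by move=> x; rewrite (adjB UV) !UB.
Qed.

(** For A self-adjoint with graph G, both (B h, T h) and (T h, h - B h) are in
    G: A B = T and A T = 1 - B.  Symmetry and positivity of T, as well as
    T^2 = B - B^2, follow from these two families of pairs. *)
Lemma selfadj_resolvent G B T : dense_domain G -> is_subspace G ->
  selfadjoint_graph G -> nonneg_graph G -> resolvent G B T ->
  [/\ positive_op T, contraction T, forall h, T (T h) = B h - B (B h) &
      forall h, B (T h) = T (B h)] /\ G = modulus_graph B T.
Proof.
move=> Gd GS Gsa Gp GB; have Bp := res_positive GB; have Bs := proj1 Bp.
have Gsym f g u v : G (f, g) -> G (u, v) -> dot g u = dot f v.
  by move=> Gf Gu; apply: (proj1 (Gsa u v) Gu).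
have G1 h : G (B h, T h) by case: (GB h).
have G2 h : G (T h, h - B h).
  apply/Gsa => f g Gg; have [_ /(_ _ _ Gg)] := GB h.
  by rewrite (dotC f) (dotC g) => ->.
have Ts : adjoint_pair T T.
  move=> h k; have := Gsym _ _ _ _ (G1 h) (G1 k).
  have := Gsym _ _ _ _ (G2 h) (G2 k); rewrite dotBl dotBr; lra.
have TBTT h : T (B h) = B (T h) /\ B h - B (B h) = T (T h).
  apply: (res_unique GS GB (G2 _)) => f g Gg.
  have := Gsym _ _ _ _ Gg (graphB GS (G1 h) (G1 (B h))).
  by rewrite !dotBr dotBl (dotC g) (dotC g) !(dotC f); lra.
have TT h : T (T h) = B h - B (B h) by case: (TBTT h).
have BT h : B (T h) = T (B h) by case: (TBTT h).
have Tp : positive_op T.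
  split=> // h; have := Gp _ _ (G1 h); have := Gp _ _ (G2 h).
  by rewrite dotBl (dotC h) (dotC (B h)); lra.
have T1 : contraction T.
  move=> h; have := dot_ge0 (h - T h); rewrite !dotBl !dotBr (dotC h (T h)).
  have : dot (T h) (T h) = dot (B h - B (B h)) h by rewrite -TT (Ts (T h)).
  by have := (positive_defect Bp (res_contraction GB)).2 h; rewrite /=; lra.
split; first by split.
have GM : G `<=` modulus_graph B T.
  move=> [u v] Guv; rewrite /modulus_graph /=; apply: dot_inj => h.
  by rewrite Ts Bs dotC (dotC v) (Gsym _ _ _ _ (G1 h) Guv).
rewrite eqEsubset; split=> // -[u v] Muv; apply/Gsa => f g /GM Mf.
have Binj h : B h = 0 -> h = 0 by apply: res_inj GB _ Gd.
by apply: (proj1 (modulus_selfadj Bp Binj Ts TT BT u v)).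
Qed.

(** B depends only on the domain and the norms, so it is common to G and M, and
    it determines a self-adjoint positive operator. *)
Theorem selfadj_modulus_unique G M :
  is_subspace G -> hclosed G -> dense_domain G ->
  selfadjoint_graph G -> nonneg_graph G ->
  is_subspace M -> dense_domain M ->
  selfadjoint_graph M -> nonneg_graph M ->
  same_modulus G M -> G = M.
Proof.
move=> GS Gc Gd Gsa Gp MS Md Msa Mp GM; have [GtoM MtoG _] := GM.
have [B [T GB]] := resolvent_exists GS Gc.
have /choice[T' hT'] : forall h, exists v, M (B h, v).
  by move=> h; apply: GtoM; apply: (proj1 (GB h)).
have MB : resolvent M B T'.
  move=> h; split=> // f v Mf; have [g Gf] := MtoG _ _ Mf.
  have [Gh /(_ _ _ Gf) ->] := GB h.
  exact: (same_modulus_dot GS MS GM Gh (hT' h) Gf Mf).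
have [[Tp T1 TT BT] ->] := selfadj_resolvent Gd GS Gsa Gp GB.
have [[Tp' T1' TT' BT'] ->] := selfadj_resolvent Md MS Msa Mp MB.
have Bp := res_positive GB.
have [Dp D1] := positive_defect Bp (res_contraction GB).
have [C [Cp C1 CC Ccomm]] := sqrt_exists Dp D1.
have sqrtE V : positive_op V -> contraction V ->
    (forall h, V (V h) = B h - B (B h)) ->
    (forall h, B (V h) = V (B h)) -> V = C.
  move=> Vp V1 VV BV; apply/esym/funext; apply: sqrt_unique => // [h|].
    by rewrite CC VV.
  by apply: (Ccomm _ _ (proj1 Vp)) => h; rewrite (adjB (proj1 Vp)) !BV.
by rewrite (sqrtE T) // (sqrtE T').
Qed.

End Graphs.

(** * Unordered sums and square summable functions *)

#[local] Existing Instance totally_filter.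

Section UnorderedSums.
Variables (R : realType) (X : choiceType).
Implicit Types (u v : X -> R) (A B : {fset X}).

Lemma totallyP (P : {fset X} -> Prop) : (\forall B \near totally, P B) <->
  exists A, forall B, (A `<=` B)%fset -> P B.
Proof. by split=> [[A _ hA]|[A hA]]; exists A. Qed.

Definition rsum u (s : R) :=
  (fun B => \sum_(i <- B) u i) @ totally --> s.

Lemma rsum_finite u A : (forall x, x \notin A -> u x = 0) ->
  rsum u (\sum_(i <- A) u i).
Proof.
move=> uA; apply: cvg_near_cst; apply/totallyP; exists A => B AB.
by apply/esym/big_fset_incl => // x _ /uA.
Qed.

Lemma rsumD u v s t : rsum u s -> rsum v t -> rsum (fun x => u x + v x) (s + t).
Proof.
rewrite /rsum => us vt; under eq_fun do rewrite big_split /=.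
exact: (cvgD us vt).
Qed.

Lemma rsumZ a u s : rsum u s -> rsum (fun x => a * u x) (a * s).
Proof.
rewrite /rsum => us; under eq_fun do rewrite -mulr_sumr.
exact: (cvgM (cvg_cst a) us).
Qed.

Lemma rsum_unique u s t : rsum u s -> rsum u t -> s = t.
Proof. by apply: cvg_unique; apply: norm_hausdorff. Qed.

Lemma ler_sum_fsub u A B : (forall x, 0 <= u x) -> (A `<=` B)%fset ->
  \sum_(i <- A) u i <= \sum_(i <- B) u i.
Proof.
move=> u0 /fsubsetP AB; rewrite [leRHS](big_fsetID _ (mem A)) /=.
rewrite (_ : [fset x in B | x \in A]%fset = A); last first.
  apply/fsetP => x; rewrite !inE.
  by case: (boolP (x \in A)) => [/AB ->|]; rewrite ?andbF.
by rewrite lerDl sumr_ge0.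
Qed.

Lemma rsum_ge u s A : (forall x, 0 <= u x) -> rsum u s ->
  \sum_(i <- A) u i <= s.
Proof.
move=> u0; rewrite /rsum => us; apply: (cvgr_to_ge us).
by apply/totallyP; exists A => B; apply: ler_sum_fsub.
Qed.

Lemma rsum_bounded u c : (forall x, 0 <= u x) ->
  (forall A, \sum_(i <- A) u i <= c) -> exists s, rsum u s.
Proof.
move=> u0 uc; pose S := range (fun A => \sum_(i <- A) u i).
have hS : has_sup S.
  split; first by exists (\sum_(i <- fset0) u i), fset0.
  by exists c => _ [A _ <-].
exists (sup S); apply/cvgrPdist_lt => e e0.
have [_ [A _ <-] hA] := sup_adherent e0 hS.
apply/totallyP; exists A => B AB; have := ler_sum_fsub u0 AB.
have : \sum_(i <- B) u i <= sup S by apply: ub_le_sup; [case: hS|exists B].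
by move=> h1 h2; rewrite ger0_norm ?subr_ge0 //; lra.
Qed.

Definition nsq (z : R[i]) : R := complex.Re z ^+ 2 + complex.Im z ^+ 2.
Lemma nsq_ge0 z : 0 <= nsq z. Proof. by rewrite addr_ge0 ?sqr_ge0. Qed.
Lemma normc_sqr z : Normc.normc z ^+ 2 = nsq z.
Proof. by case: z => a b; rewrite /= sqr_sqrtr // addr_ge0 ?sqr_ge0. Qed.

(** Complex sums split into real ones, for which monotonicity is available. *)
Lemma has_sumP (u : X -> R[i]) s : has_sum u s <->
  rsum (fun x => complex.Re (u x)) (complex.Re s) /\
  rsum (fun x => complex.Im (u x)) (complex.Im s).
Proof.
have ReS (r : seq X) : complex.Re (\sum_(i <- r) u i) =
    \sum_(i <- r) complex.Re (u i).
  elim: r => [|x r IH]; rewrite ?big_nil // !big_cons -IH.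
  by case: (u x) (\sum_(_ <- _) _) => [? ?] [].
have ImS (r : seq X) : complex.Im (\sum_(i <- r) u i) =
    \sum_(i <- r) complex.Im (u i).
  elim: r => [|x r IH]; rewrite ?big_nil // !big_cons -IH.
  by case: (u x) (\sum_(_ <- _) _) => [? ?] [].
have psE B : partial_sum (u : X -> R[i]^o) B = \sum_(i <- B) u i.
  by rewrite /partial_sum big_seq_fsetE.
have distE (z w : R[i]) : `|z - w| =
    (Num.sqrt ((complex.Re z - complex.Re w) ^+ 2 +
     (complex.Im z - complex.Im w) ^+ 2))%:C%C.
  by case: z w => [a b] [c d].
split.
  move=> /cvgrPdist_lt h; split; apply/cvgrPdist_lt => e e0.
    have /totallyP[A hA] := h e%:C%C ltac:(by rewrite ltcR).
    apply/totallyP; exists A => B /hA; rewrite psE -ReS distE ltcR.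
    apply: le_lt_trans.
    by rewrite -sqrtr_sqr ler_wsqrtr // lerDl sqr_ge0.
  have /totallyP[A hA] := h e%:C%C ltac:(by rewrite ltcR).
  apply/totallyP; exists A => B /hA; rewrite psE -ImS distE ltcR.
  apply: le_lt_trans.
  by rewrite -sqrtr_sqr ler_wsqrtr // lerDr sqr_ge0.
move=> [/cvgrPdist_lt h /cvgrPdist_lt k]; apply/cvgrPdist_lt => -[e e'].
rewrite ltcE /= => /andP[/eqP -> e0].
have e2 : 0 < e / 2 by lra.
have /totallyP[A hA] := h _ e2; have /totallyP[B hB] := k _ e2.
apply/totallyP; exists (A `|` B)%fset => C; rewrite fsubUset.
move=> /andP[/hA/= ha /hB/= hb].
rewrite psE distE ltcR ReS ImS.
rewrite -(gtr0_norm e0) -sqrtr_sqr ltr_sqrt ?exprn_gt0 //.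
move: ha hb; rewrite !ltr_norml => /andP[a1 a2] /andP[b1 b2].
by nra.
Qed.

Lemma has_sum_unique (u : X -> R[i]) s t : has_sum u s -> has_sum u t -> s = t.
Proof.
move=> /has_sumP[a b] /has_sumP[a' b'].
have := rsum_unique a a'; have := rsum_unique b b'.
by case: s {a b} => s1 s2; case: t {a' b'} => t1 t2 /= -> ->.
Qed.

Lemma sum_has_sum (u : X -> R[i]) s : has_sum u s -> sum (u : X -> R[i]^o) = s.
Proof. by move=> us; apply: cvg_lim => //; apply: norm_hausdorff. Qed.

Implicit Types (f g h : X -> R[i]).

Lemma sqnorm2_le f c : (sqnorm2 f <= c%:E)%E <->
  forall A, \sum_(i <- A) nsq (f i) <= c.
Proof.
have E A : (\sum_(x \in [set` A]) (Normc.normc (f x) ^+ 2)%:E)%E =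
    (\sum_(i <- A) nsq (f i))%:E.
  rewrite fsumEFin // fsbig_finite // set_fsetK; congr (_%:E).
  by apply: eq_bigr => i _; rewrite normc_sqr.
split=> [h A|h].
  rewrite -lee_fin -E; apply: le_trans h; apply: ereal_sup_ubound.
  by exists [set` A] => //; split.
apply: ge_ereal_sup => _ [F [Ff _] <-].
by rewrite -(fset_setK Ff) E lee_fin.
Qed.

Lemma ell2P f : ell2 f <-> exists c, forall A, \sum_(i <- A) nsq (f i) <= c.
Proof.
split=> [|[c /sqnorm2_le h]]; last first.
  exact: le_lt_trans h (ltry _).
have : (0 <= sqnorm2 f)%E.
  by apply: esum_ge0 => x _; rewrite lee_fin sqr_ge0.
rewrite /ell2 /=; case E : (sqnorm2 f) => [c| |] // _ _.
by exists c; apply/sqnorm2_le; rewrite E.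
Qed.

Lemma ell2_rsum f : ell2 f <-> exists s, rsum (fun x => nsq (f x)) s.
Proof.
rewrite ell2P; split=> [[c]|[s fs]].
  by apply: rsum_bounded => x; apply: nsq_ge0.
by exists s => A; apply: rsum_ge fs => x; apply: nsq_ge0.
Qed.

Lemma sqnorm2_rsum f s : rsum (fun x => nsq (f x)) s -> sqnorm2 f = s%:E.
Proof.
move=> fs; apply/eqP; rewrite eq_le; apply/andP; split.
  by apply/sqnorm2_le => A; apply: rsum_ge fs => x; apply: nsq_ge0.
have : ell2 f by apply/ell2_rsum; exists s.
have : (0 <= sqnorm2 f)%E.
  by apply: esum_ge0 => x _; rewrite lee_fin sqr_ge0.
rewrite /ell2 /=; case E : (sqnorm2 f) => [c| |] // _ _.
rewrite lee_fin; move: fs; rewrite /rsum => fs.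
apply: (cvgr_to_le fs).
apply/totallyP; exists fset0 => B _; move: B; apply/sqnorm2_le; rewrite E //.
Qed.

Definition cdot_re (z w : R[i]) : R :=
  complex.Re z * complex.Re w + complex.Im z * complex.Im w.

Lemma ell2Z a f : ell2 f -> ell2 (fun x => a * f x).
Proof.
move=> /ell2_rsum[s fs]; apply/ell2_rsum; exists (nsq a * s).
rewrite (_ : (fun _ => _) = fun x => nsq a * nsq (f x)); first exact: rsumZ.
apply/funext => x; rewrite /nsq; case: a (f x) => [a b] [c d] /=; ring.
Qed.

Lemma ell2D f g : ell2 f -> ell2 g -> ell2 (fun x => f x + g x).
Proof.
move=> /ell2P[c fc] /ell2P[d gd]; apply/ell2P; exists (2 * c + 2 * d) => A.
apply: (@le_trans _ _ (\sum_(i <- A) (2 * nsq (f i) + 2 * nsq (g i)))).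
  apply: ler_sum => i _; rewrite /nsq.
  case: (f i) (g i) => [p q] [r s] /=.
  by have := sqr_ge0 (p - r); have := sqr_ge0 (q - s); nra.
by rewrite big_split -!mulr_sumr /= lerD // ler_pM2l.
Qed.

(** Polarization reduces products to squares. *)
Lemma ell2_dot f g : ell2 f -> ell2 g ->
  exists s, rsum (fun x => cdot_re (f x) (g x)) s.
Proof.
move=> hf hg; have /ell2_rsum[s fgs] := ell2D hf hg.
move: hf hg => /ell2_rsum[t ft] /ell2_rsum[r gr].
exists (2^-1 * (s + (-1) * (t + r))).
have := rsumZ (a := 2^-1) (rsumD fgs (rsumZ (a := -1) (rsumD ft gr))).
congr (rsum _ _); apply/funext => x; rewrite /cdot_re /nsq.
by case: (f x) (g x) => [p q] [u v] /=; field.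
Qed.

Lemma has_sum_dot2 f g : ell2 f -> ell2 g ->
  has_sum (fun x => f x * (g x)^*) (dot2 f g).
Proof.
move=> hf hg; have [s fs] := ell2_dot hf hg.
have [t ft] := ell2_dot (ell2Z (- 'i%C) hf) hg.
suff h : has_sum (fun x => f x * (g x)^*) (s +i* t)%C.
  by rewrite /dot2 (sum_has_sum h).
apply/has_sumP; split=> /=; [move: fs|move: ft];
  congr (rsum _ _); apply/funext => x; rewrite /cdot_re;
  case: (f x) (g x) => [p q] [u v] /=; ring.
Qed.

End UnorderedSums.

(** * The Hilbert space of square summable functions *)

Record ell2_vec (R : realType) (X : choiceType) :=
  Ell2Vec { ell2_fun :> X -> R[i]; ell2_funP : ell2 ell2_fun }.

Section Ell2Module.
Variables (R : realType) (X : choiceType).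
Local Notation V := (ell2_vec R X).
Implicit Types (f g h : V).

Lemma ell2_ext f g : (forall x, f x = g x) -> f = g.
Proof.
case: f g => [f Pf] [g Pg] /= /funext fg; move: Pf Pg; rewrite fg => Pf Pg.
by congr Ell2Vec; apply: Prop_irrelevance.
Qed.

HB.instance Definition _ := gen_eqMixin V.
HB.instance Definition _ := gen_choiceMixin V.

Definition ell2_scale (c : R[i]) f : V := Ell2Vec (ell2Z c (ell2_funP f)).
Definition ell2_add f g : V := Ell2Vec (ell2D (ell2_funP f) (ell2_funP g)).

Lemma ell2_0 : ell2 (fun _ : X => 0 : R[i]).
Proof.
apply/ell2_rsum; exists (\sum_(i <- @fset0 X) nsq (0 : R[i])).
by apply: rsum_finite => x _; rewrite /nsq /= expr0n addr0.
Qed.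

Fact ell2_addA : associative ell2_add.
Proof. by move=> f g h; apply: ell2_ext => x /=; rewrite addrA. Qed.
Fact ell2_addC : commutative ell2_add.
Proof. by move=> f g; apply: ell2_ext => x /=; rewrite addrC. Qed.
Fact ell2_add0 : left_id (Ell2Vec ell2_0) ell2_add.
Proof. by move=> f; apply: ell2_ext => x /=; rewrite add0r. Qed.
Fact ell2_addN : left_inverse (Ell2Vec ell2_0) (ell2_scale (-1)) ell2_add.
Proof. by move=> f; apply: ell2_ext => x /=; rewrite mulN1r addNr. Qed.

HB.instance Definition _ :=
  GRing.isZmodule.Build V ell2_addA ell2_addC ell2_add0 ell2_addN.

Definition ell2_rscale (a : R) f : V := ell2_scale a%:C%C f.
Fact ell2_scaleA a b f :
  ell2_rscale a (ell2_rscale b f) = ell2_rscale (a * b) f.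
Proof. by apply: ell2_ext => x /=; rewrite rmorphM mulrA. Qed.
Fact ell2_scale1 : left_id 1 ell2_rscale.
Proof. by move=> f; apply: ell2_ext => x /=; rewrite mul1r. Qed.
Fact ell2_scaleDr : right_distributive ell2_rscale +%R.
Proof. by move=> a f g; apply: ell2_ext => x /=; rewrite mulrDr. Qed.
Fact ell2_scaleDl f : {morph ell2_rscale^~ f : a b / a + b}.
Proof. by move=> a b; apply: ell2_ext => x /=; rewrite rmorphD mulrDl. Qed.

HB.instance Definition _ := GRing.Zmodule_isLmodule.Build R V
  ell2_scaleA ell2_scale1 ell2_scaleDr ell2_scaleDl.

Lemma ell2_addE f g x : (f + g) x = f x + g x. Proof. by []. Qed.
Lemma ell2_oppE f x : (- f) x = - f x.
Proof. by rewrite -mulN1r. Qed.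
Lemma ell2_subE f g x : (f - g) x = f x - g x.
Proof. by rewrite ell2_addE ell2_oppE. Qed.
Lemma ell2_scaleE a f x : (a *: f) x = a%:C%C * f x. Proof. by []. Qed.
Lemma ell2_zeroE x : (0 : V) x = 0. Proof. by []. Qed.

Definition ell2_rdot f g : R := complex.Re (dot2 f g).

Lemma ell2_rdotP f g : rsum (fun x => cdot_re (f x) (g x)) (ell2_rdot f g).
Proof.
have /has_sumP[h _] := has_sum_dot2 (ell2_funP f) (ell2_funP g).
move: h; congr (rsum _ _); apply/funext => x; rewrite /cdot_re.
by case: (f x) (g x) => [p q] [u v] /=; ring.
Qed.

Arguments ell2_rdotP f g : clear implicits.

Lemma ell2_rdotC f g : ell2_rdot f g = ell2_rdot g f.
Proof.
apply: (rsum_unique (ell2_rdotP f g)); move: (ell2_rdotP g f).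
by congr (rsum _ _); apply/funext => x; rewrite /cdot_re; ring.
Qed.

Lemma ell2_rdot_lin a f g h :
  ell2_rdot (a *: f + g) h = a * ell2_rdot f h + ell2_rdot g h.
Proof.
apply: (rsum_unique (ell2_rdotP _ _)).
move: (rsumD (rsumZ (a := a) (ell2_rdotP f h)) (ell2_rdotP g h)).
congr (rsum _ _); apply/funext => x; rewrite ell2_addE ell2_scaleE /cdot_re.
by case: (f x) (g x) (h x) => [p q] [u v] [w z] /=; ring.
Qed.

Lemma ell2_rdot_sq f : rsum (fun x => nsq (f x)) (ell2_rdot f f).
Proof. exact: (ell2_rdotP f f). Qed.

Arguments ell2_rdot_sq f : clear implicits.

Lemma sqnorm2E f : sqnorm2 f = (ell2_rdot f f)%:E.
Proof. exact: (sqnorm2_rsum (ell2_rdot_sq f)). Qed.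

Lemma ell2_rdot_ge f (A : {fset X}) :
  \sum_(i <- A) nsq (f i) <= ell2_rdot f f.
Proof.
by apply: (@rsum_ge _ _ _ _ A _ (ell2_rdot_sq f)) => x; apply: nsq_ge0.
Qed.

Lemma ell2_rdot_ge0 f : 0 <= ell2_rdot f f.
Proof. by have := ell2_rdot_ge f fset0; rewrite big_seq_fset0. Qed.

Lemma nsq_le_rdot f x : nsq (f x) <= ell2_rdot f f.
Proof. by have := ell2_rdot_ge f [fset x]%fset; rewrite big_seq_fset1. Qed.

Lemma ell2_rdot_eq0 f : ell2_rdot f f = 0 -> f = 0.
Proof.
move=> f0; apply: ell2_ext => x; have := nsq_le_rdot f x.
rewrite f0 /nsq ell2_zeroE; case: (f x) => [a b] /= h.
have := sqr_ge0 a; have := sqr_ge0 b => b0 a0.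
have /eqP : a ^+ 2 = 0 by lra.
have /eqP : b ^+ 2 = 0 by lra.
by rewrite !sqrf_eq0 => /eqP -> /eqP ->.
Qed.

Lemma real_cauchy_cvg (a : nat -> R) :
  (forall e, 0 < e -> exists N, forall m n, (N <= m)%N -> (N <= n)%N ->
     `|a m - a n| < e) -> exists l : R, a @ \oo --> l.
Proof.
move=> h; suff /cauchy_cvgP : cauchy (a @ \oo).
  by move=> /cvg_ex.
apply/cauchyP => e e0; have [N hN] := h _ e0.
by exists (a N), N => // n /= Nn; apply: hN.
Qed.

(** The limit is taken pointwise; the estimate survives on each finite set of
    indices and hence for the whole sum. *)
Lemma ell2_complete (u : nat -> V) :
  (forall e, 0 < e -> exists N, forall m n, (N <= m)%N -> (N <= n)%N ->
     ell2_rdot (u m - u n) (u m - u n) < e) ->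
  exists l, forall e, 0 < e -> exists N, forall n, (N <= n)%N ->
     ell2_rdot (u n - l) (u n - l) < e.
Proof.
move=> uC.
have coord e x : 0 < e -> exists N, forall m n, (N <= m)%N -> (N <= n)%N ->
    nsq (u m x - u n x) < e ^+ 2.
  move=> e0; have [N hN] := uC _ (exprn_gt0 2 e0); exists N => m n Nm Nn.
  apply: le_lt_trans (hN _ _ Nm Nn); rewrite -ell2_subE; exact: nsq_le_rdot.
have /choice[a ha] : forall x, exists l : R,
    (fun n => complex.Re (u n x)) @ \oo --> l.
  move=> x; apply: real_cauchy_cvg => e e0.
  have [N hN] := coord e x e0; exists N => m n Nm Nn; have k := hN _ _ Nm Nn.
  rewrite -ltr_sqr ?nnegrE ?(ltW e0) // real_normK ?num_real //.
  apply: le_lt_trans k.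
  rewrite /nsq; case: (u m x) (u n x) => [p q] [r s] /=.
  by rewrite lerDl sqr_ge0.
have /choice[b hb] : forall x, exists l : R,
    (fun n => complex.Im (u n x)) @ \oo --> l.
  move=> x; apply: real_cauchy_cvg => e e0.
  have [N hN] := coord e x e0; exists N => m n Nm Nn; have k := hN _ _ Nm Nn.
  rewrite -ltr_sqr ?nnegrE ?(ltW e0) // real_normK ?num_real //.
  apply: le_lt_trans k.
  rewrite /nsq; case: (u m x) (u n x) => [p q] [r s] /=.
  by rewrite lerDr sqr_ge0.
pose l x := (a x +i* b x)%C.
have lim n x : (fun m => nsq (u n x - u m x)) @ \oo --> nsq (u n x - l x).
  have E z w : nsq (z - w) = (complex.Re z - complex.Re w) ^+ 2 +
      (complex.Im z - complex.Im w) ^+ 2 by case: z w => [? ?] [? ?].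
  rewrite E; under eq_fun do rewrite E.
  rewrite /= !expr2; under eq_fun do rewrite !expr2.
  have c1 : (fun m => complex.Re (u n x) - complex.Re (u m x)) @ \oo -->
      complex.Re (u n x) - a x by apply: cvgB => //; apply: cvg_cst.
  have c2 : (fun m => complex.Im (u n x) - complex.Im (u m x)) @ \oo -->
      complex.Im (u n x) - b x by apply: cvgB => //; apply: cvg_cst.
  by apply: cvgD; apply: cvgM.
have near e : 0 < e -> exists N, forall n, (N <= n)%N ->
    forall A : {fset X}, \sum_(i <- A) nsq (u n i - l i) <= e.
  move=> e0; have [N hN] := uC _ e0; exists N => n Nn A.
  have c : (fun m => \sum_(i <- A) nsq (u n i - u m i)) @ \oo -->
      \sum_(i <- A) nsq (u n i - l i).
    elim: (enum_fset A) => [|x s IH].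
      by rewrite big_nil; under eq_fun do rewrite big_nil; apply: cvg_cst.
    by rewrite big_cons; under eq_fun do rewrite big_cons; apply: cvgD.
  apply: (cvgr_to_le c); exists N => // m /= Nm.
  under eq_bigr do rewrite -ell2_subE.
  by apply: le_trans (ell2_rdot_ge _ _) _; apply/ltW/hN.
have ul n : (exists N, (N <= n)%N /\
    forall A : {fset X}, \sum_(i <- A) nsq (u n i - l i) <= 1) -> ell2 l.
  move=> [N [Nn hN]].
  have d : ell2 (fun x => u n x - l x) by apply/ell2P; exists 1.
  have := ell2D (ell2_funP (u n)) (ell2Z (-1) d).
  by congr ell2; apply/funext => x; rewrite mulN1r opprB addrC subrK.
have [N hN] := near 1 ltr01.
have hl : ell2 l by apply: (ul N); exists N; split=> //; apply: hN.
exists (Ell2Vec hl) => e e0; have [M hM] := near (e / 2) ltac:(lra).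
exists M => n Mn; apply: (@le_lt_trans _ _ (e / 2)); last by lra.
rewrite -lee_fin -sqnorm2E; apply/sqnorm2_le => A.
by under eq_bigr do rewrite ell2_subE; apply: hM.
Qed.

Definition ell2_hilbert : hilbert R := Hilbert ell2_rdotC ell2_rdot_lin
  ell2_rdot_ge0 ell2_rdot_eq0 ell2_complete.

End Ell2Module.

(** * The complex structure *)

Section Ell2Complex.
Variables (R : realType) (X : choiceType).
Local Notation V := (ell2_hilbert R X).
Implicit Types (f g h : V) (c : R[i]).

Definition cscale c f : V := ell2_scale c f.
Local Notation J := (cscale 'i%C).

Lemma cscaleE c f (x : X) : cscale c f x = c * f x. Proof. by []. Qed.

Lemma cscale_real c f : cscale c f = complex.Re c *: f + complex.Im c *: J f.
Proof.
apply: ell2_ext => x; rewrite cscaleE ell2_addE !ell2_scaleE cscaleE.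
by case: c (f x) => [a b] [p q]; congr Complex; rewrite /=; ring.
Qed.

Lemma cscaleN c f : cscale (- c) f = - cscale c f.
Proof. by apply: ell2_ext => x; rewrite ell2_oppE !cscaleE mulNr. Qed.

Lemma dot_rsum f g : rsum (fun x => cdot_re (f x) (g x)) (dot f g).
Proof. exact: ell2_rdotP. Qed.
Arguments dot_rsum f g : clear implicits.

(** The complex inner product is recovered from the real one and from
    multiplication by i. *)
Lemma dot2E f g : dot2 f g = (dot f g +i* dot f (J g))%C.
Proof.
have /has_sumP[_ h] := has_sum_dot2 (ell2_funP f) (ell2_funP g).
rewrite [dot f g]/(complex.Re (dot2 f g)) -(rsum_unique h (t := dot f (J g))).
  by case: (dot2 f g).
move: (dot_rsum f (J g)); congr (rsum _ _); apply/funext => x.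
rewrite /cdot_re cscaleE; case: (f x) (g x) => [p q] [u v] /=; ring.
Qed.

Lemma adjJ : adjoint_pair J (cscale (- 'i%C)).
Proof.
move=> f g; apply: (rsum_unique (dot_rsum _ _)).
move: (dot_rsum f (cscale (- 'i%C) g)); congr (rsum _ _); apply/funext => x.
rewrite /cdot_re !cscaleE; case: (f x) (g x) => [p q] [u v] /=; ring.
Qed.

Lemma cscale_ii f : J (J f) = - f.
Proof.
by apply: ell2_ext => x; rewrite ell2_oppE !cscaleE mulrA -expr2 sqr_i mulN1r.
Qed.

Lemma dotJ f g : dot (J f) g = - dot f (J g).
Proof. by rewrite adjJ cscaleN dotNr. Qed.

Lemma normJ f : norm (J f) = norm f.
Proof. by apply: norm_eq; rewrite dotJ cscale_ii dotNr opprK. Qed.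

Lemma dot2C f g : dot2 f g = (dot2 g f)^*.
Proof.
rewrite !dot2E -[RHS]/(dot g f -i* dot g (J f))%C dotC (dotC g (J f)).
by rewrite dotJ opprK. Qed.

Lemma dot2Dl f g h : dot2 (f + g : V) h = dot2 f h + dot2 g h.
Proof. by rewrite !dot2E !dotDl. Qed.

Lemma dot2Zl c f g : dot2 (cscale c f) g = c * dot2 f g.
Proof.
rewrite !dot2E cscale_real !dotDl !dotZl !dotJ cscale_ii dotNr.
by case: c => a b; congr Complex; rewrite /=; ring.
Qed.

Lemma dot20l f : dot2 (0 : V) f = 0.
Proof. by rewrite dot2E !dot0l. Qed.

Definition csum n (a : 'I_n -> R[i]) (v : 'I_n -> V) : V :=
  \sum_(j < n) cscale (a j) (v j).

Lemma csumE n a v (y : X) : @csum n a v y = \sum_(j < n) a j * v j y.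
Proof.
apply: (big_morph (fun f : V => f y) (op1 := +%R) (op2 := +%R)) => //.
Qed.

Lemma dot2_csuml n a v g :
  dot2 (@csum n a v) g = \sum_(j < n) a j * dot2 (v j) g.
Proof.
rewrite /csum (big_morph (fun f : V => dot2 f g) (id1 := 0) (op1 := +%R)).
- by apply: eq_bigr => j _; rewrite dot2Zl.
- by move=> f h; rewrite dot2Dl.
- exact: dot20l.
Qed.

Lemma dot2_csum n a v m b w : dot2 (@csum n a v) (@csum m b w) =
  \sum_(j < n) \sum_(k < m) a j * (b k)^* * dot2 (v j) (w k).
Proof.
rewrite dot2_csuml; apply: eq_bigr => j _.
rewrite dot2C dot2_csuml rmorph_sum mulr_sumr; apply: eq_bigr => k _.
by rewrite rmorphM (dot2C (v j)) mulrA.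
Qed.

Fact ell2_delta (x : X) : ell2 (fun y => (y == x)%:R : R[i]).
Proof.
apply/ell2_rsum.
exists (\sum_(i <- [fset x]%fset) nsq ((i == x)%:R : R[i])).
apply: rsum_finite => y; rewrite inE => /negPf ->.
by rewrite /nsq /= expr0n addr0.
Qed.
Definition delta (x : X) : V := Ell2Vec (ell2_delta x).

Lemma deltaE x y : delta x y = (y == x)%:R. Proof. by []. Qed.

Lemma dot2_delta f x : dot2 f (delta x) = f x.
Proof.
apply: has_sum_unique (has_sum_dot2 (ell2_funP _) (ell2_funP _)) _.
have E : (fun y => f y * (delta x y)^*) =
    fun y => if y == x then f x else 0.
  apply/funext => y; rewrite deltaE; case: eqP => [->|_].
    by rewrite rmorph1 mulr1.
  by rewrite rmorph0 mulr0.
have supp (z : R[i] -> R) : z 0 = 0 ->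
    rsum (fun y => z (if y == x then f x else 0)) (z (f x)).
  move=> z0; have := @rsum_finite _ _
    (fun y => z (if y == x then f x else 0)) [fset x]%fset.
  by rewrite big_seq_fset1 eqxx; apply => y; rewrite inE => /negPf ->.
by rewrite E; apply/has_sumP; split; apply: supp.
Qed.

End Ell2Complex.
Arguments delta {R X} x.

(** * Kernels with square summable rows *)

Section Kernels.
Variables (R : realType) (X : choiceType).
Local Notation V := (ell2_hilbert R X).
Local Notation VV := (prod_hilbert V V).
Local Notation J := (cscale 'i%C).
Implicit Types (f g h u v : V) (k : X -> V).

(** Two points suffice: the imaginary part of the quadratic form vanishes at the
    coefficients (1, 0), (0, 1), (1, 1) and (1, i). *)
Lemma pos_def_hermitian (K : ckernel R X) : positive_definite K ->
  forall x y, K y x = (K x y)^*.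
Proof.
move=> Kp x y.
have im (z w : R[i]) : complex.Im (z * z^* * K x x + z * w^* * K x y +
    (w * z^* * K y x + w * w^* * K y y)) = 0.
  have := Kp 2 (fun j => if j == ord0 then x else y)
    (fun j => if j == ord0 then z else w) isT.
  rewrite !big_ord_recl !big_ord0 /= !addr0.
  exact: ger0_Im.
have h1 := im 1 0; have h2 := im 0 1; have h3 := im 1 1; have h4 := im 1 'i%C.
move: h1 h2 h3 h4.
case: (K x x) (K x y) (K y x) (K y y) => [a a'] [b b'] [c c'] [d d'].
rewrite -[(b +i* b')%C^*]/(b -i* b')%C => /= h1 h2 h3 h4.
congr Complex; lra.
Qed.

Definition kernel_of k : ckernel R X := fun x y => k x y.
Definition kgraph k : set VV :=
  [set p | Kop (kernel_of k) (ell2_fun p.1, ell2_fun p.2)].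

Lemma fsum_support (f F : X -> R[i]) (A : {fset X}) :
  (forall x, x \notin A -> f x = 0) ->
  \sum_(x \in [set: X]) f x * F x = \sum_(x <- A) f x * F x.
Proof.
move=> fA; rewrite -[A in RHS]set_fsetK -fsbig_finite //.
apply/esym/fsbig_widen => //.
by move=> x [_ /= /negP/fA ->]; rewrite mul0r.
Qed.

Lemma ell_fin_support (f : X -> R[i]) : ell_fin f ->
  exists A : {fset X}, forall x, x \notin A -> f x = 0.
Proof.
move=> ff; exists (fset_set [set x | f x != 0]) => x.
rewrite in_fset_set // => /negP h; apply/eqP/negPn/negP => k.
by apply: h; rewrite inE.
Qed.

Lemma support_ell_fin (f : X -> R[i]) (A : {fset X}) :
  (forall x, x \notin A -> f x = 0) -> ell_fin f.
Proof.
move=> fA; apply: (sub_finite_set _ (finite_fset A)) => x /= fx.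
by apply/negPn/negP => /fA h; rewrite h eqxx in fx.
Qed.

Lemma KopP (K : ckernel R X) (f g : X -> R[i]) : Kop K (f, g) <->
  exists A : {fset X}, (forall x, x \notin A -> f x = 0) /\
    forall y, g y = \sum_(x <- A) f x * K x y.
Proof.
split=> [[h /ell_fin_support[A hA] [<- <-]]|[A [fA gE]]].
  by exists A; split=> // y; apply: fsum_support.
exists f; first exact: support_ell_fin fA.
by congr pair; apply/funext => y; rewrite gE; apply: fsum_support.
Qed.

Lemma kgraph_lin k c p q : kgraph k p -> kgraph k q ->
  kgraph k (cscale c p.1 + q.1, cscale c p.2 + q.2).
Proof.
have widen (f F : X -> R[i]) (A B : {fset X}) : (A `<=` B)%fset ->
    (forall x, x \notin A -> f x = 0) ->
    \sum_(x <- A) f x * F x = \sum_(x <- B) f x * F x.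
  by move=> AB fA; apply: big_fset_incl => // x _ /fA ->; rewrite mul0r.
move=> /KopP[A [fA gA]] /KopP[B [fB gB]]; apply/KopP; exists (A `|` B)%fset.
split=> [x|y].
  rewrite inE negb_or => /andP[/fA h1 /fB h2].
  by rewrite -[LHS]/(c * p.1 x + q.1 x) h1 h2 mulr0 addr0.
rewrite -[LHS]/(c * p.2 y + q.2 y) gA gB.
rewrite (widen _ _ _ (A `|` B)%fset _ fA) ?fsubsetUl //.
rewrite (widen _ _ _ (A `|` B)%fset _ fB) ?fsubsetUr //.
rewrite mulr_sumr -big_split /=; apply: eq_bigr => x _.
by rewrite -[RHS]/((c * p.1 x + q.1 x) * _) mulrDl mulrA.
Qed.

Lemma kgraph_delta k x : kgraph k (delta x, k x).
Proof.
apply/KopP; exists [fset x]%fset; split=> [y|y].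
  by rewrite inE deltaE => /negPf ->.
by rewrite big_seq_fset1 deltaE eqxx mul1r.
Qed.

Lemma kgraph0 k : kgraph k (0, 0).
Proof.
by apply/KopP; exists fset0; split=> // y; rewrite big_seq_fset0.
Qed.

Lemma kgraph_subspace k : is_subspace (kgraph k).
Proof.
split=> [|a p q Kp Kq]; first exact: kgraph0.
exact: (kgraph_lin a%:C%C Kp Kq).
Qed.

Lemma kgraph_scale k c f g :
  kgraph k (f, g) -> kgraph k (cscale c f, cscale c g).
Proof.
by move=> h; have := kgraph_lin c h (kgraph0 k); rewrite !addr0.
Qed.

Lemma graph_csum (S : set VV) n (a : 'I_n -> R[i]) (v w : 'I_n -> V) :
  is_subspace S ->
  (forall c f g, S (f, g) -> S (cscale c f, cscale c g)) ->
  (forall j, S (v j, w j)) -> S (csum a v, csum a w).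
Proof.
move=> SS Sc Svw; rewrite /csum.
elim/big_ind2 : _ => [|f g f' g' h h'|j _]; first by case: SS.
  exact: (graphD SS h h').
exact: Sc.
Qed.

Lemma kgraph_csum k n (a : 'I_n -> R[i]) (x : 'I_n -> X) :
  kgraph k (csum a (delta \o x), csum a (k \o x)).
Proof.
apply: graph_csum => [|c f g|j]; first exact: kgraph_subspace.
  exact: kgraph_scale.
exact: kgraph_delta.
Qed.

(** The coefficients and points depend on f alone; this is what allows two
    kernels to be compared on the same vector. *)
Lemma kgraph_rep k f g : kgraph k (f, g) ->
  exists n (a : 'I_n -> R[i]) (x : 'I_n -> X), f = csum a (delta \o x) /\
    forall k' v, kgraph k' (f, v) <-> v = csum a (k' \o x).
Proof.
move=> /KopP[A [fA _]].
pose x (j : 'I_(size A)) := tnth (in_tuple A) j; pose a j := f (x j).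
have repE (F : X -> R[i]) : \sum_(z <- A) f z * F z = \sum_j a j * F (x j).
  by rewrite big_tnth.
have fE : f = csum a (delta \o x).
  apply: ell2_ext => y; rewrite csumE -(repE (fun z => (delta z : V) y)).
  have [yA|yA] := boolP (y \in A).
    rewrite (big_fsetD1 y) //= eqxx mulr1 big_seq big1 ?addr0 // => z.
    by rewrite !inE eq_sym => /andP[/negPf -> _]; rewrite mulr0.
  rewrite fA // big_seq big1 //= => z zA.
  by case: eqP => [yz|]; [rewrite yz zA in yA|rewrite mulr0].
have kE k' v : kgraph k' (f, v) -> v = csum a (k' \o x).
  move=> [h _ [hf hv]]; apply: ell2_ext => y; rewrite csumE.
  by rewrite -(repE (fun z => k' z y)) -hv hf; apply: fsum_support.
exists (size A), a, x; split=> // k' v; split=> [|->]; first exact: kE.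
by rewrite fE; apply: kgraph_csum.
Qed.

Lemma Kop_ell2 k (f g : X -> R[i]) : Kop (kernel_of k) (f, g) ->
  exists p : VV, [/\ kgraph k p, f = p.1 & g = p.2].
Proof.
move=> fg; have /KopP[A [fA gE]] := fg.
have hf : ell2 f.
  apply/ell2_rsum; exists (\sum_(i <- A) nsq (f i)).
  by apply: rsum_finite => x /fA ->; rewrite /nsq /= expr0n addr0.
pose G := csum (fun j : 'I_(size A) => f (tnth (in_tuple A) j))
   (k \o tnth (in_tuple A)).
have gG : g = ell2_fun G by apply/funext => y; rewrite csumE gE big_tnth.
by exists (Ell2Vec hf, G); rewrite /kgraph /= -gG.
Qed.

Lemma dot2_csum_delta k n (a : 'I_n -> R[i]) (x : 'I_n -> X) :
  dot2 (csum a (k \o x)) (csum a (delta \o x)) =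
  \sum_(j < n) \sum_(l < n) a j * (a l)^* * kernel_of k (x j) (x l).
Proof.
by rewrite dot2_csum; do 2![apply: eq_bigr => ? _]; rewrite dot2_delta.
Qed.

End Kernels.

(** * Self-adjointness over the reals and over the complex numbers *)

Section Operators.
Variables (R : realType) (X : choiceType).
Local Notation V := (ell2_hilbert R X).
Local Notation VV := (prod_hilbert V V).
Local Notation J := (cscale 'i%C).
Implicit Types (f g h u v : V) (k : X -> V) (S M : set VV).

(** These are the complex subspaces: scaling by a + b i is a real combination of
    the identity and of multiplication by i. *)
Definition clinear S := is_subspace S /\ forall f g, S (f, g) -> S (J f, J g).

Lemma clinear_scale S c f g :
  clinear S -> S (f, g) -> S (cscale c f, cscale c g).
Proof.
move=> [SS SJ] Sfg; rewrite (cscale_real c f) (cscale_real c g).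
exact: graphD SS (subspaceZ _ SS Sfg) (subspaceZ _ SS (SJ _ _ Sfg)).
Qed.

Lemma clinear_hclosure S : clinear S -> clinear (hclosure S).
Proof.
move=> [SS SJ]; split; first exact: hclosure_subspace.
move=> f g [w Sw wfg]; exists (fun n => (J (w n).1, J (w n).2)).
  by move=> n; apply: SJ; rewrite -surjective_pairing.
have tendsJ (u : nat -> V) x : tends u x -> tends (fun n => J (u n)) (J x).
  rewrite /tends; under [in X in _ -> X]eq_fun do
    rewrite -(adjB (@adjJ R X)) normJ.
  by [].
apply: tends_pair; apply: tendsJ; [exact: (tends_fst wfg)|].
exact: (tends_snd wfg).
Qed.

Lemma clinear_kgraph k : clinear (kgraph k).
Proof. by split; [exact: kgraph_subspace|move=> f g; apply: kgraph_scale]. Qed.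

Definition op_of S : op_graph R X :=
  [set p | exists f g, S (f, g) /\ p = (f : X -> R[i], g : X -> R[i])].

Lemma op_ofP S f g : op_of S (f : X -> R[i], g : X -> R[i]) <-> S (f, g).
Proof.
split=> [[f' [g' [Sfg []]]]|Sfg]; last by exists f, g.
move=> /(congr1 (fun F x => F x)) /funeqP ff /funeqP gg.
by rewrite (ell2_ext ff) (ell2_ext gg).
Qed.

Lemma sqnorm2_lt f e : 0 < e -> (sqnorm2 f < (e ^+ 2)%:E)%E <-> norm f < e.
Proof. by move=> e0; rewrite sqnorm2E lte_fin norm_lt // ltW. Qed.

Lemma sub_fun f g : (f : X -> R[i]) - (g : X -> R[i]) = (f - g : V).
Proof. by apply/funext => x; rewrite ell2_subE. Qed.

Lemma op_closure_Kop k :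
  op_closure (Kop (kernel_of k)) = op_of (hclosure (kgraph k)).
Proof.
rewrite eqEsubset; split=> [[F G]|].
  move=> [/= hF hG near]; pose f : V := Ell2Vec hF; pose g : V := Ell2Vec hG.
  exists f, g; split=> //; apply: hclosureP => e e0; have e2 : 0 < e / 2 by lra.
  have [[F' G'] /Kop_ell2[[f' g'] [kq -> ->]] [/= h1 h2]] := near _ e2.
  exists (f', g') => //; move: h1 h2.
  rewrite (sub_fun f) (sub_fun g) !sqnorm2_lt // => h1 h2.
  by apply: le_lt_trans (norm_prod_le _) _ => /=; lra.
move=> _ [f [g [Sfg ->]]]; split=> [||e e0].
- exact: ell2_funP.
- exact: ell2_funP.
have [[f' g'] kq near] := hclosure_near Sfg e0.
exists (f' : X -> R[i], g' : X -> R[i]) => //=; rewrite !sub_fun !sqnorm2_lt //.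
by split; apply: le_lt_trans near;
  [exact: (norm_fst ((f, g) - (f', g') : VV))
  |exact: (norm_snd ((f, g) - (f', g') : VV))].
Qed.

(** Real parts suffice: up to sign, the imaginary part of the identity for
    (f, g) is its real part for (i f, i g). *)
Lemma adjoint_op_of S u v : clinear S ->
  adjoint (op_of S) (u : X -> R[i], v : X -> R[i]) <->
  forall f g, S (f, g) -> dot g u = dot f v.
Proof.
move=> [SS SJ]; split=> [[/= _ _ h] f g Sfg|h].
  have := h f g (ex_intro _ f (ex_intro _ g (conj Sfg erefl))).
  by rewrite !dot2E => -[].
split=> [||F G [f [g [Sfg [-> ->]]]]] /=; [exact: ell2_funP|exact: ell2_funP|].
rewrite !dot2E (h _ _ Sfg); congr Complex.
by have := h _ _ (SJ _ _ Sfg); rewrite !dotJ => /oppr_inj.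
Qed.

Lemma selfadj_op_of S : clinear S ->
  op_of S = adjoint (op_of S) <-> selfadjoint_graph S.
Proof.
move=> SC; split=> [E u v|sa].
  by rewrite -op_ofP {1}E; apply: adjoint_op_of.
rewrite eqEsubset; split=> [_ [f [g [Sfg ->]]]|[F G] FG].
  by apply/adjoint_op_of => //; apply/sa.
have [/= hF hG _] := FG.
pose f : V := Ell2Vec hF; pose g : V := Ell2Vec hG.
by apply/(op_ofP S f g)/sa/(adjoint_op_of f g SC).
Qed.

Lemma dense_domain_delta S : clinear S ->
  (forall x, exists g, S (delta x, g)) ->
  dense_domain S.
Proof.
move=> [_ SJ] Sd h perp; apply: ell2_ext => x; have [g Sx] := Sd x.
by rewrite -dot2_delta dot2E (perp _ _ Sx) (perp _ _ (SJ _ _ Sx)).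
Qed.

Lemma self_adjoint_op_of S : clinear S ->
  (forall x, exists g, S (delta x, g)) -> selfadjoint_graph S ->
  self_adjoint (op_of S).
Proof.
move=> SC Sd sa; have [SS SJ] := SC.
have Su : univalent S.
  move=> g S0; apply: (dense_domain_delta SC Sd) => u v Suv.
  by have := (sa u v).1 Suv _ _ S0; rewrite dot0l.
split; last by apply/selfadj_op_of.
- split.
  + by move=> _ [f [g [_ ->]]]; split; apply: ell2_funP.
  + by apply/(op_ofP S 0 0); case: SS.
  + move=> a _ _ _ _ [f [g [Sfg [-> ->]]]] [f' [g' [Sfg' [-> ->]]]].
    apply/(op_ofP S (cscale a f + f') (cscale a g + g')).
    exact: graphD SS (clinear_scale a SC Sfg) Sfg'.
  + move=> _ _ G' [f [g [Sfg [-> ->]]]] [f' [g' [Sfg' [ff ->]]]].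
    have E : f = f' by apply: ell2_ext => x; rewrite ff.
    by rewrite E in Sfg; rewrite (univalentP SS Su Sfg Sfg').
move=> F hF e e0; pose f : V := Ell2Vec hF.
pose D : set V := [set u | exists v, S (u, v)].
have DS : is_subspace D.
  split; first by exists 0; case: SS.
  move=> a u u' [v Suv] [v' Suv']; exists (a *: v + v').
  by case: SS => _ h; apply: (h a _ _ Suv Suv').
have Dcl : setT `<=` hclosure D.
  apply: dense_perp => // g _ perp.
  by apply: (dense_domain_delta SC Sd) => u v Suv; apply: perp; exists v.
have [u [v Suv] near] := hclosure_near (Dcl f I) e0.
exists (u : X -> R[i]).
  by exists (u : X -> R[i], v : X -> R[i]) => //; exists u, v.
by rewrite (sub_fun f) sqnorm2_lt.
Qed.

End Operators.

(** * Roots of a kernel *)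

Section Roots.
Variables (R : realType) (X : choiceType).
Local Notation V := (ell2_hilbert R X).
Local Notation VV := (prod_hilbert V V).
Local Notation J := (cscale 'i%C).
Implicit Types (f g h u v : V) (k : X -> V) (S M : set VV) (L K : ckernel R X).

Lemma root_rows L K : pdms_root L K -> exists2 k : X -> V, K = kernel_of k &
  forall x z, L x z = dot2 (k x) (k z).
Proof.
move=> [Kp KL]; have Kh := pos_def_hermitian Kp.
have rowK x : ell2 (K x).
  have /has_sumP[h _] := KL x x; apply/ell2_rsum; exists (complex.Re (L x x)).
  move: h; congr (rsum _ _); apply/funext => y; rewrite (Kh x y) /nsq.
  by case: (K x y) => [a b]; rewrite /=; ring.
exists (fun x => Ell2Vec (rowK x)) => // x z; apply: has_sum_unique (KL x z) _.
have := has_sum_dot2 (rowK x) (rowK z); congr (has_sum _ _); apply/funext => y.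
by rewrite (Kh z y).
Qed.

Section Kernel.
Variable k : X -> V.
Hypothesis kp : positive_definite (kernel_of k).
Let kh x y : k y x = (k x y)^*. Proof. exact: (pos_def_hermitian kp). Qed.
Local Notation G := (hclosure (kgraph k)).

(** K_op is symmetric because K is hermitian; this makes it closable. *)
Lemma kgraph_sym f g z : kgraph k (f, g) -> dot2 g (delta z) = dot2 f (k z).
Proof.
move=> fg; have [n [a [x [fE gE]]]] := kgraph_rep fg.
have /gE -> := fg; rewrite fE !dot2_csuml; apply: eq_bigr => j _ /=.
by rewrite dot2_delta (dot2C (delta _)) dot2_delta -kh.
Qed.

Lemma kclosure_univalent : univalent G.
Proof.
move=> g [w kw wg]; apply: ell2_ext => z; rewrite -dot2_delta.
have E n : dot2 (w n).2 (delta z) = dot2 (w n).1 (k z).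
  by apply: kgraph_sym; rewrite -surjective_pairing.
have w1 := tends_fst wg; have w2 := tends_snd wg.
rewrite dot2E; congr Complex.
  rewrite -[RHS](dot0l (k z)).
  apply: (dot_lim_eq w2 (tends_cst _) w1 (tends_cst _)) => n.
  by have := E n; rewrite !dot2E => -[].
rewrite -[RHS](dot0l (J (k z))).
apply: (dot_lim_eq w2 (tends_cst _) w1 (tends_cst _)) => n.
by have := E n; rewrite !dot2E => -[].
Qed.

Lemma kclosure_delta x : G (delta x, k x).
Proof. by apply: subset_hclosure; apply: kgraph_delta. Qed.

Lemma kclosure_dense : dense_domain G.
Proof.
apply: dense_domain_delta; first exact/clinear_hclosure/clinear_kgraph.
by move=> x; exists (k x); apply: kclosure_delta.
Qed.

Lemma kclosure_nonneg : nonneg_graph G.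
Proof.
move=> f g [w kw wfg]; suff : dot (0 : V) (0 : V) <= dot g f by rewrite dot0l.
apply: (dot_lim_le (tends_cst _) (tends_cst _) (tends_snd wfg) (tends_fst wfg)).
move=> m; rewrite dot0l; case: (w m) (kw m) => {wfg kw}{}f {}g /= fg.
have [n [a [x [fE gE]]]] := kgraph_rep fg; have {gE}/gE gE := fg.
suff : 0 <= dot2 g f by rewrite dot2E lecE => /andP[].
rewrite fE gE dot2_csum_delta.
(* Positive definiteness only speaks of nonempty families of points. *)
case: n a x {fE gE} => [|n] a x; first by rewrite big_ord0.
by apply: kp.
Qed.

End Kernel.

(** For f with coefficients a_j at points x_j, the square norm of K_op f is
    sum a_j (a_l)^* L(x_j, x_l) for every root K of L. *)
Lemma root_same_modulus L k k' :
  positive_definite (kernel_of k) -> positive_definite (kernel_of k') ->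
  (forall x z, L x z = dot2 (k x) (k z)) ->
  (forall x z, L x z = dot2 (k' x) (k' z)) ->
  same_modulus (hclosure (kgraph k)) (hclosure (kgraph k')).
Proof.
move=> kp kp' kL kL'.
pose Z f g v := kgraph k (f, g) /\ kgraph k' (f, v).
have iso f g v : Z f g v -> norm g = norm v.
  move=> [fg fv]; apply: norm_eq.
  have [n [a [x [_ E]]]] := kgraph_rep fg.
  have /E gE := fg; have /E vE := fv.
  suff : dot2 g g = dot2 v v by rewrite !dot2E => -[].
  rewrite gE vE !dot2_csum; do 2![apply: eq_bigr => ? _].
  by rewrite -kL -kL'.
have dom k1 k2 f g : kgraph k1 (f, g) -> exists v, kgraph k2 (f, v).
  by move=> /kgraph_rep[n [a [x [_ E]]]]; exists (csum a (k2 \o x)); apply/E.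
apply: (@same_modulus_closure _ _ Z).
- exact/hclosure_subspace/kgraph_subspace.
- exact: hclosure_closed.
- exact: kclosure_univalent.
- exact/hclosure_subspace/kgraph_subspace.
- exact: hclosure_closed.
- exact: kclosure_univalent.
- move=> f g v Zfgv; split; last exact: iso Zfgv.
    by apply: subset_hclosure; case: Zfgv.
  by apply: subset_hclosure; case: Zfgv.
- move=> f g v f' g' v' [fg fv] [fg' fv']; apply: (iso (f - f')).
  by split; apply: graphB => //; apply: kgraph_subspace.
- by apply: hclosureS => -[f g] fg; have [v fv] := dom _ k' _ _ fg; exists v.
- by apply: hclosureS => -[f v] fv; have [g fg] := dom _ k _ _ fv; exists g.
Qed.

Lemma root_unique L K K' :
  pdms_root L K -> self_adjoint (op_closure (Kop K)) ->
  pdms_root L K' -> self_adjoint (op_closure (Kop K')) -> K = K'.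
Proof.
move=> KL Ksa KL' Ksa'.
have [k KE kL] := root_rows KL; have [k' KE' kL'] := root_rows KL'.
have kp : positive_definite (kernel_of k) by rewrite -KE; case: KL.
have kp' : positive_definite (kernel_of k') by rewrite -KE'; case: KL'.
have sa k0 : self_adjoint (op_closure (Kop (kernel_of k0))) ->
    selfadjoint_graph (hclosure (kgraph k0)).
  move=> [_ _]; rewrite op_closure_Kop; apply: (selfadj_op_of _).1.
  exact/clinear_hclosure/clinear_kgraph.
rewrite KE in Ksa; rewrite KE' in Ksa'.
have E : hclosure (kgraph k) = hclosure (kgraph k').
  apply: selfadj_modulus_unique (root_same_modulus kp kp' kL kL').
  - exact/hclosure_subspace/kgraph_subspace.
  - exact: hclosure_closed.
  - exact: kclosure_dense.
  - exact: sa.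
  - exact: kclosure_nonneg.
  - exact/hclosure_subspace/kgraph_subspace.
  - exact: kclosure_dense.
  - exact: sa.
  - exact: kclosure_nonneg.
rewrite KE KE'; apply/funext => x; apply/funext => y.
have h := kclosure_delta k x; have h' := kclosure_delta k' x; rewrite -E in h'.
have GS : is_subspace (hclosure (kgraph k)).
  exact/hclosure_subspace/kgraph_subspace.
by rewrite /kernel_of (univalentP GS (kclosure_univalent kp) h h').
Qed.

Lemma root_exists L K0 : pdms_root L K0 ->
  exists K, pdms_root L K /\ self_adjoint (op_closure (Kop K)).
Proof.
move=> K0L; have [k0 K0E k0L] := root_rows K0L.
have k0p : positive_definite (kernel_of k0) by rewrite -K0E; case: K0L.
pose G := hclosure (kgraph k0).
have GC : clinear G by exact/clinear_hclosure/clinear_kgraph.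
have [GS GJ] := GC.
have [M [[MS Mc] [Msa Mp] GM Minv]] := modulus_exists GS
  (@hclosure_closed _ _ _) (@kclosure_dense k0) (kclosure_univalent k0p).
have MC : clinear M.
  split=> // f g; apply: (Minv _ _ (@adjJ R X)) => //.
  by move=> u v; apply: clinear_scale.
have [GtoM MtoG _] := GM.
have /choice[k Mk] : forall x, exists v, M (delta x, v).
  by move=> x; apply: GtoM; apply: kclosure_delta.
have kM : kgraph k `<=` M.
  move=> [f g] fg; have [n [a [x [fE gE]]]] := kgraph_rep fg.
  have /gE -> := fg; rewrite fE; apply: graph_csum => // [c u v|j].
    exact: clinear_scale.
  exact: Mk.
have Msym f g : M (f, g) -> dot2 g f = (dot g f)%:C%C.
  move=> Mfg; rewrite dot2E; congr Complex; have [_ MJ] := MC.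
  have := (Msa _ _).1 Mfg _ _ (MJ _ _ Mfg); rewrite !dotJ (dotC f) dotJ; lra.
have kp : positive_definite (kernel_of k).
  move=> n x a _; rewrite -dot2_csum_delta.
  have Mx := kM _ (kgraph_csum k a x).
  by rewrite (Msym _ _ Mx) ler0c; apply: Mp.
have kL x z : L x z = dot2 (k x) (k z).
  rewrite k0L !dot2E; congr Complex.
    apply: (same_modulus_dot GS MS GM _ (Mk x) _ (Mk z)); exact: kclosure_delta.
  apply: (same_modulus_dot GS MS GM _ (Mk x) _ (MC.2 _ _ (Mk z))).
    exact: kclosure_delta.
  by apply: GJ; apply: kclosure_delta.
(* Finitely supported vectors are a core of the modulus, and on such vectors it
   agrees with the operator of the new kernel. *)
have MdenseK : M `<=` hclosure (kgraph k).
  apply: subset_trans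
    (core_transfer GS MS GM (@subset_hclosure _ _ _) _) _ => //.
  apply: hclosureS => -[f v] [Mfv [g /kgraph_rep[n [a [x [_ E]]]]]].
  have kf : kgraph k (f, csum a (k \o x)) by apply/E.
  have Mu : univalent M.
    move=> w M0w; apply: (@kclosure_dense k0) => u w' Gu.
    have [v' Mv'] := GtoM _ _ Gu.
    by have := (Msa _ _).1 Mv' _ _ M0w; rewrite dot0l.
  by rewrite (univalentP MS Mu Mfv (kM _ kf)).
have clM : hclosure (kgraph k) = M.
  by rewrite eqEsubset; split=> // p kp'; apply: Mc; apply: hclosureS kp'.
exists (kernel_of k); split; last first.
  rewrite op_closure_Kop clM; apply: self_adjoint_op_of => // x.
  by exists (k x).
split=> // x z; rewrite kL.
have := has_sum_dot2 (ell2_funP (k x)) (ell2_funP (k z)).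
congr (has_sum _ _); apply/funext => y.
by rewrite -(pos_def_hermitian kp z y).
Qed.

End Roots.

Theorem corollary5p10 (R : realType) (X : choiceType) (hX : [set: X] !=set0)
    (L : ckernel R X) (hL : positive_definite L)
    (hroot : exists K : ckernel R X, pdms_root L K) :
  exists! K : ckernel R X, pdms_root L K /\ self_adjoint (op_closure (Kop K)).
Proof.
have [K0 K0L] := hroot; have [K [KL Ksa]] := root_exists K0L.
by exists K; split=> // K' [KL' Ksa']; apply: root_unique KL Ksa KL' Ksa'.
Qed.
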